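(* Assume GCH. Then $\mathrm{HC}(\kappa)$ holds for every cardinal $\kappa$ with $\mathrm{cf}(\kappa) \notin \{\mu^+ : \mathrm{cf}(\mu) = \omega\}$.
   Context: A ray is a one-way infinite path. Two rays in a graph $G$ are equivalent if there are infinitely many pairwise vertex-disjoint paths between them in $G$; an end of $G$ is an equivalence class of rays. The degree of an end $\varepsilon$ is the maximum cardinality of a set of pairwise disjoint rays in $\varepsilon$. Given a set $\mathcal{R}$ of pairwise disjoint equivalent rays in $G$, an $\mathcal{R}$-path is a path meeting $\bigcup\mathcal{R}$ exactly in its two endvertices; a set of paths is independent if no inner vertex of one of them lies on another. A graph $H$ with vertex set $\mathcal{R}$ is a ray graph in $G$ if there is a set $\mathcal{P}$ of independent $\mathcal{R}$-paths in $G$ such that for each edge $RS$ of $H$ there are infinitely many disjoint $R$--$S$ paths in $\mathcal{P}$. $\mathrm{HC}(\kappa)$ is the statement: for every graph $G$ and every end $\varepsilon$ of $G$ of degree $\kappa$, there is a set $\mathcal{R}\subseteq\varepsilon$ of $\kappa$ pairwise disjoint rays admitting a connected ray graph in $G$ with vertex set $\mathcal{R}$. *)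

(* Defs.v *)
(* Cardinals are represented by types (cardinality of a type),
   graphs by a symmetric irreflexive adjacency relation on a type of vertices. *)
From Stdlib Require Import List Relations.
Import ListNotations.

(* A fixed universe of "sets": all types below live in CType. *)
Definition CType : Type := Type.

Definition le_card (A B : Type) : Prop :=
  exists f : A -> B, forall x y, f x = f y -> x = y.
Definition lt_card (A B : Type) : Prop := le_card A B /\ ~ le_card B A.
Definition infinite_type (A : Type) : Prop := le_card nat A.

Definition GCH : Prop :=
  forall X Y : CType, infinite_type X -> ~ (lt_card X Y /\ lt_card Y (X -> Prop)).

Definition strict_well_order {A : Type} (lt : A -> A -> Prop) : Prop :=
  (forall x, ~ lt x x) /\
  (forall x y z, lt x y -> lt y z -> lt x z) /\
  (forall x y, lt x y \/ x = y \/ lt y x) /\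
  well_founded lt.

(* a well-order of A of initial order type, i.e. A ordered as the cardinal |A|:
   every proper initial segment has cardinality < |A| *)
Definition initial_order {A : Type} (lt : A -> A -> Prop) : Prop :=
  strict_well_order lt /\ forall x, lt_card {y : A | lt y x} A.

Definition cofinal {A : Type} (lt : A -> A -> Prop) (P : A -> Prop) : Prop :=
  forall x, exists c, P c /\ ~ lt c x.

Definition cf_is (K C : CType) : Prop :=
  exists lt : K -> K -> Prop, initial_order lt /\
    (exists f : C -> K, (forall x y, f x = f y -> x = y) /\
                        cofinal lt (fun k => exists c, f c = k)) /\
    (forall (D : CType) (g : D -> K),
        cofinal lt (fun k => exists d, g d = k) -> le_card C D).

Definition is_succ_card (M C : CType) : Prop :=
  lt_card M C /\ forall D : CType, lt_card M D -> le_card C D.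

Definition cf_succ_of_cof_omega (K : CType) : Prop :=
  exists C M : CType, cf_is K C /\ is_succ_card M C /\ cf_is M nat.

Section Graph.
Variable V : Type.
Variable adj : V -> V -> Prop.

Definition simple_graph : Prop :=
  (forall x y, adj x y -> adj y x) /\ (forall x, ~ adj x x).

Definition is_ray (r : nat -> V) : Prop :=
  (forall m n, r m = r n -> m = n) /\ (forall n, adj (r n) (r (S n))).

Definition on_ray (r : nat -> V) (v : V) : Prop := exists n, r n = v.

Fixpoint walk (l : list V) : Prop :=
  match l with
  | x :: ((y :: _) as t) => adj x y /\ walk t
  | _ => True
  end.

Definition is_path (p : list V) : Prop := p <> [] /\ NoDup p /\ walk p.

Definition first_vertex (p : list V) (x : V) : Prop := hd_error p = Some x.
Definition last_vertex (p : list V) (y : V) : Prop := hd_error (rev p) = Some y.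

Definition inner_vertex (p : list V) (v : V) : Prop :=
  In v p /\ ~ first_vertex p v /\ ~ last_vertex p v.

Definition disjoint_paths (p q : list V) : Prop := forall v, In v p -> ~ In v q.

Definition AB_path (A B : V -> Prop) (p : list V) : Prop :=
  is_path p /\ exists x y, first_vertex p x /\ last_vertex p y /\ A x /\ B y /\
    (forall v, In v p -> A v -> v = x) /\ (forall v, In v p -> B v -> v = y).

Definition equiv_rays (r s : nat -> V) : Prop :=
  exists P : nat -> list V,
    (forall n, AB_path (on_ray r) (on_ray s) (P n)) /\
    (forall m n, m <> n -> disjoint_paths (P m) (P n)).

Definition is_end (E : (nat -> V) -> Prop) : Prop :=
  exists r0, is_ray r0 /\ forall r, E r <-> (is_ray r /\ equiv_rays r r0).

Definition disjoint_ray_family {I : Type} (R : I -> nat -> V) : Prop :=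
  forall i j, i <> j -> forall v, on_ray (R i) v -> ~ on_ray (R j) v.

Definition end_degree (E : (nat -> V) -> Prop) (K : CType) : Prop :=
  (exists R : K -> nat -> V, (forall i, E (R i)) /\ disjoint_ray_family R) /\
  (forall (I : CType) (R : I -> nat -> V),
      (forall i, E (R i)) -> disjoint_ray_family R -> le_card I K).

Section RayFamily.
Variable K : Type.
Variable R : K -> nat -> V.

Definition in_union_rays (v : V) : Prop := exists k, on_ray (R k) v.

Definition R_path (p : list V) : Prop :=
  is_path p /\ exists x y, first_vertex p x /\ last_vertex p y /\ x <> y /\
    forall v, In v p -> (in_union_rays v <-> (v = x \/ v = y)).

Definition independent (P : list V -> Prop) : Prop :=
  forall p q, P p -> P q -> p <> q -> forall v, inner_vertex p v -> ~ In v q.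

Definition joins (i j : K) (p : list V) : Prop :=
  exists x y, first_vertex p x /\ last_vertex p y /\
    ((on_ray (R i) x /\ on_ray (R j) y) \/ (on_ray (R j) x /\ on_ray (R i) y)).

Definition ray_graph (H : K -> K -> Prop) : Prop :=
  exists P : list V -> Prop,
    (forall p, P p -> R_path p) /\ independent P /\
    forall i j, H i j ->
      exists Q : nat -> list V,
        (forall n, P (Q n) /\ joins i j (Q n)) /\
        (forall m n, m <> n -> disjoint_paths (Q m) (Q n)).
End RayFamily.
End Graph.

Definition connected_graph {K : Type} (H : K -> K -> Prop) : Prop :=
  (forall x y, H x y -> H y x) /\ (forall x, ~ H x x) /\
  forall x y, clos_refl_trans K H x y.

Definition HC (K : CType) : Prop :=
  forall (V : CType) (adj : V -> V -> Prop), @simple_graph V adj ->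
  forall E : (nat -> V) -> Prop, @is_end V adj E -> @end_degree V E K ->
  exists R : K -> nat -> V,
    (forall i, E (R i)) /\ @disjoint_ray_family V K R /\
    exists H : K -> K -> Prop, connected_graph H /\ @ray_graph V adj K R H.

(* Main.v *)
From Stdlib Require Import List Relations Arith Lia Wellfounded Cantor ListDec.
From Stdlib Require Import Classical ClassicalEpsilon FunctionalExtensionality PropExtensionality ProofIrrelevance.
From mathcomp Require boolp wochoice.
Require Import Defs.
Import ListNotations.

(* A ray of the end is linked to any other member by infinitely many disjoint paths, so no finite
   set separates them. Call a countable sequence U a hub if many rays of the end send fans onto
   it, i.e. infinitely many disjoint paths ending at U 0, U 1, ..., such that the fans of
   different rays meet only in U. No finite set separates two points of a hub, so some ray runs
   through all of U, and it is the centre of a star of rays.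

   Hubs come from a closure argument: if mu^omega < kappa for all mu < kappa, kappa regular, and no
   hub carries kappa fans, then closing a ray off, in omega_1 steps, under adding a maximal system of
   fans onto each countable U gives a set of size < kappa; a ray avoiding it sends a fan
   onto a countable subset of it, against maximality. Under GCH the hypothesis on cf(kappa)
   says that an uncountable cofinality lambda satisfies mu^omega < lambda for all mu < lambda.

   For singular kappa (a strong limit) one takes hubs carrying more and more fans, indexed by
   the cofinality, and thins the fans out until they are disjoint. If the cofinality is omega, a single
   ray runs through all hubs; otherwise the closure argument, applied to the hubs
   themselves, links them to a common countable set, giving a star of stars.

   For kappa <= omega one looks for an infinite subfamily in which any two rays are joined by a
   chain of pairs with infinitely many disjoint paths avoiding the other rays. *)

(** * Cardinalities of types *)

(** The closure argument is run over an abstract ideal of [small] types. Two ideals serve: the types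
    smaller than an uncountable cofinality, which is where the assumption on $\mathrm{cf}(\kappa)$
    enters, and the types of size at most $2^B$ for infinite $B$, which are closed under countable
    powers whatever the cofinality of $B$. The second kind produces the hubs for singular $\kappa$.

    There are $\omega_1$ stages because a countable sequence in their union then lies in a single
    stage, so that the systems of fans onto it have already been added.

    For singular $\kappa$ of uncountable cofinality the obstacle is that a ray is countable and
    cannot in general run through all hubs, while different hubs may overlap. The linking paths
    therefore decide which hub points are used, and rays set aside in advance supply the material
    for a separate ray through the used points of each hub.

    A family that is too large does no harm: the degree bounds it, so it can be reindexed by
    $\kappa$. *)

Notation seg lt x := {y | lt y x}.

Lemma sig_inj {A : Type} {P : A -> Prop} (x y : {a | P a}) :
  proj1_sig x = proj1_sig y -> x = y.
Proof.
  destruct x as [x hx], y as [y hy]; simpl; intros ->.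
  f_equal; apply proof_irrelevance.
Qed.

Lemma choice_fun {A B : Type} (P : A -> B -> Prop) :
  (forall a, exists b, P a b) -> exists f : A -> B, forall a, P a (f a).
Proof.
  intros h.
  exists (fun a => proj1_sig (constructive_indefinite_description _ (h a))).
  intros a; apply proj2_sig.
Qed.

Lemma choice_dep {A : Type} {B : A -> Type} (P : forall a, B a -> Prop) :
  (forall a, exists b, P a b) -> exists f : forall a, B a, forall a, P a (f a).
Proof.
  intros h.
  exists (fun a => proj1_sig (constructive_indefinite_description _ (h a))).
  intros a; apply proj2_sig.
Qed.

Lemma le_card_refl (A : Type) : le_card A A.
Proof. exists (fun x => x); auto. Qed.

Lemma le_card_trans (A B C : Type) : le_card A B -> le_card B C -> le_card A C.
Proof. intros [f hf] [g hg]; exists (fun x => g (f x)); auto. Qed.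

Lemma le_card_surj {A B : Type} (g : B -> A) :
  (forall a, exists b, g b = a) -> le_card A B.
Proof.
  intros h; destruct (choice_fun _ h) as [f hf].
  exists f; intros x y e; rewrite <- (hf x), <- (hf y), e; auto.
Qed.

Lemma le_card_surj_inv (A B : Type) :
  le_card A B -> inhabited A -> exists g : B -> A, forall a, exists b, g b = a.
Proof.
  intros [f hf] [a0].
  assert (h : forall b, exists a, forall a', f a' = b -> a' = a).
  { intros b; destruct (classic (exists a, f a = b)) as [[a ha]|no].
    - exists a; intros a' e; apply hf; congruence.
    - exists a0; intros a' e; exfalso; eauto. }
  destruct (choice_fun _ h) as [g hg].
  exists g; intros a; exists (f a); symmetry; auto.
Qed.

Lemma le_card_sig (A : Type) (P : A -> Prop) : le_card {a | P a} A.
Proof. exists (@proj1_sig _ _); intros; apply sig_inj; auto. Qed.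

Lemma le_card_sub {A : Type} (P Q : A -> Prop) :
  (forall a, P a -> Q a) -> le_card {a | P a} {a | Q a}.
Proof.
  intros h; exists (fun x => exist _ (proj1_sig x) (h _ (proj2_sig x))).
  intros x y e; apply sig_inj; inversion e; auto.
Qed.

Lemma le_card_prod (A B C D : Type) :
  le_card A B -> le_card C D -> le_card (A * C) (B * D).
Proof.
  intros [f hf] [g hg]; exists (fun p => (f (fst p), g (snd p))).
  intros [a c] [a' c']; simpl; intros e; inversion e; f_equal; auto.
Qed.

Lemma le_card_fun (I A B : Type) : le_card A B -> le_card (I -> A) (I -> B).
Proof.
  intros [f hf]; exists (fun u i => f (u i)); intros u v e.
  extensionality i; apply hf; exact (f_equal (fun w => w i) e).
Qed.

Lemma le_card_pow (A B : Type) : le_card A B -> le_card (A -> Prop) (B -> Prop).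
Proof.
  intros [f hf]; exists (fun P b => exists a, f a = b /\ P a); intros P Q e.
  extensionality a; apply propositional_extensionality.
  pose proof (f_equal (fun w => w (f a)) e) as h; simpl in h.
  split; intros hp.
  - assert (h' : exists a', f a' = f a /\ Q a') by (rewrite <- h; eauto).
    destruct h' as [a' [e' q]]; apply hf in e'; congruence.
  - assert (h' : exists a', f a' = f a /\ P a') by (rewrite h; eauto).
    destruct h' as [a' [e' q]]; apply hf in e'; congruence.
Qed.

Lemma cantor_bernstein (A B : Type) :
  le_card A B -> le_card B A ->
  exists f : A -> B, (forall x y, f x = f y -> x = y) /\ (forall b, exists a, f a = b).
Proof.
  intros [f hf] [g hg].
  pose (S := fun a => exists n a0, (forall b, g b <> a0) /\ a = Nat.iter n (fun x => g (f x)) a0).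
  assert (hpre : forall a, ~ S a -> exists b, g b = a).
  { intros a na; apply NNPP; intros no; apply na.
    exists 0, a; split; auto; intros b e; eauto. }
  assert (ex : forall a, exists b, (S a -> b = f a) /\ (~ S a -> g b = a)).
  { intros a; destruct (classic (S a)) as [s|s].
    - exists (f a); tauto.
    - destruct (hpre a s) as [b hb]; exists b; tauto. }
  destruct (choice_fun _ ex) as [h hh]; exists h.
  assert (hS : forall x y, S x -> ~ S y -> h x <> h y).
  { intros x y sx sy e; apply sy.
    rewrite <- (proj2 (hh y) sy), <- e, (proj1 (hh x) sx).
    destruct sx as [n [a0 [h0 ->]]]; exists (Datatypes.S n), a0; split; auto. }
  split.
  - intros x y e; destruct (classic (S x)) as [sx|sx], (classic (S y)) as [sy|sy].
    + apply hf; rewrite <- (proj1 (hh x) sx), <- (proj1 (hh y) sy); auto.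
    + destruct (hS x y sx sy e).
    + destruct (hS y x sy sx (eq_sym e)).
    + rewrite <- (proj2 (hh x) sx), <- (proj2 (hh y) sy), e; auto.
  - intros b; destruct (classic (S (g b))) as [s|s].
    + destruct s as [n [a0 [h0 e]]]; destruct n as [|n]; simpl in e.
      * exfalso; exact (h0 b e).
      * apply hg in e; exists (Nat.iter n (fun x => g (f x)) a0).
        rewrite e; apply hh; exists n, a0; auto.
    + exists (g b); apply hg, hh, s.
Qed.

(** The imported principle gives a boolean relation with a unique minimum on every nonempty subset.
    Existence on pairs makes it total, uniqueness on pairs makes it antisymmetric. *)
Lemma strict_well_order_exists (A : Type) : exists lt : A -> A -> Prop, strict_well_order lt.
Proof.
  destruct (wochoice.well_ordering_principle (boolp.boolp_classicType__canonical__eqtype_Equality A)) as [R hR].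
  change (ssrbool.rel A) in R.
  assert (hmin : forall P : A -> Prop, (exists a, P a) ->
            exists z, P z /\ forall a, P a -> R z a = true).
  { intros P [a ha].
    destruct (hR (fun a => boolp.asbool (P a))) as [z [[hz1 hz2] _]].
    - exists a; apply (boolp.asboolT ha).
    - exists z; split.
      + apply boolp.asboolW, hz1.
      + intros b hb; apply hz2, (boolp.asboolT hb). }
  assert (hanti : forall x y, R x y = true -> R y x = true -> x = y).
  { intros x y h1 h2.
    destruct (hR (fun a => boolp.asbool (a = x \/ a = y))) as [z [_ hu]].
    - exists x; apply boolp.asboolT; auto.
    - assert (hxx : forall a, R a a = true).
      { intros a; destruct (hmin (fun b => b = a)) as [w [-> hw]]; eauto. }
      assert (hm : forall w, w = x \/ w = y ->
        wochoice.minimum_of R (fun a => boolp.asbool (a = x \/ a = y)) w).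
      { intros w hw; split; [exact (boolp.asboolT hw)|].
        intros b hb; apply boolp.asboolW in hb.
        unfold is_true; destruct hw, hb; subst; auto. }
      rewrite <- (hu x (hm x (or_introl eq_refl))); auto. }
  exists (fun x y => R x y = true /\ x <> y).
  assert (tot : forall x y, R x y = true \/ R y x = true).
  { intros x y; destruct (hmin (fun b => b = x \/ b = y)) as [w [[-> | ->] hw]]; eauto. }
  split; [|split; [|split]].
  - intros x [_ h]; auto.
  - intros x y z [h1 n1] [h2 n2]; split.
    + destruct (hmin (fun b => b = x \/ b = y \/ b = z)) as [w [[-> |[-> | ->]] hw]]; eauto.
      * assert (x = y) by (apply hanti; auto); congruence.
      * assert (z = y) by (apply hanti; auto); congruence.
    + intros ->; assert (z = y) by (apply hanti; auto); congruence.
  - intros x y; destruct (classic (x = y)) as [e|e]; auto.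
    destruct (tot x y); auto.
  - intros a; apply NNPP; intros na.
    destruct (hmin (fun b => ~ Acc (fun x y => R x y = true /\ x <> y) b)) as [z [hz hm]]; eauto.
    apply hz; constructor; intros y [h1 h2]; apply NNPP; intros ny.
    apply h2, hanti; auto.
Qed.

(** * Well-orders and the comparison of cardinals *)

Section WellOrder.
Context {A : Type} {lt : A -> A -> Prop} (wo : strict_well_order lt).

Lemma swo_irrefl x : ~ lt x x.
Proof. apply wo. Qed.

Lemma swo_trans x y z : lt x y -> lt y z -> lt x z.
Proof. apply wo. Qed.

Lemma swo_total x y : lt x y \/ x = y \/ lt y x.
Proof. apply wo. Qed.

Lemma swo_wf : well_founded lt.
Proof. apply wo. Qed.

Lemma swo_asym x y : lt x y -> ~ lt y x.
Proof. intros h1 h2; exact (swo_irrefl x (swo_trans _ _ _ h1 h2)). Qed.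

Lemma swo_le_lt x y z : ~ lt y x -> lt y z -> lt x z.
Proof.
  intros h1 h2; destruct (swo_total x y) as [h|[->|h]]; auto.
  - eapply swo_trans; eauto.
  - contradiction.
Qed.

Lemma swo_min (P : A -> Prop) :
  (exists x, P x) -> exists x, P x /\ forall y, lt y x -> ~ P y.
Proof.
  intros [x hx]; apply NNPP; intros no.
  revert hx; induction x as [x IH] using (well_founded_induction swo_wf).
  intros hx; apply no; exists x; split; auto.
Qed.

Lemma swo_pullback {B : Type} (f : B -> A) :
  (forall x y, f x = f y -> x = y) -> strict_well_order (fun x y => lt (f x) (f y)).
Proof.
  intros hf; split; [|split; [|split]].
  - intros x; apply swo_irrefl.
  - intros x y z; apply swo_trans.
  - intros x y; destruct (swo_total (f x) (f y)) as [h|[h|h]]; auto.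
  - apply wf_inverse_image, swo_wf.
Qed.

(* Only the fibres of [f] are ordered by the second relation, so any well-order will do there. *)
Lemma swo_lex {B : Type} (f : B -> A) (lt' : B -> B -> Prop) :
  strict_well_order lt' ->
  strict_well_order (fun x y => lt (f x) (f y) \/ (f x = f y /\ lt' x y)).
Proof.
  intros (i' & t' & c' & w'); split; [|split; [|split]].
  - intros x [h|[_ h]]; [exact (swo_irrefl _ h)|exact (i' _ h)].
  - intros x y z [h1|[e1 h1]] [h2|[e2 h2]].
    + left; eapply swo_trans; eauto.
    + left; rewrite <- e2; auto.
    + left; rewrite e1; auto.
    + right; split; [congruence|eauto].
  - intros x y; destruct (swo_total (f x) (f y)) as [h|[h|h]]; auto.
    destruct (c' x y) as [k|[k|k]]; auto.
  - assert (h : forall a b, f b = a ->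
      Acc (fun x y => lt (f x) (f y) \/ (f x = f y /\ lt' x y)) b).
    { intros a; induction a as [a IHa] using (well_founded_induction swo_wf).
      intros b; induction b as [b IHb] using (well_founded_induction w').
      intros e; constructor; intros c [hc|[e' hc]].
      - rewrite e in hc; exact (IHa _ hc _ eq_refl).
      - apply IHb; congruence. }
    intros b; exact (h _ b eq_refl).
Qed.

(** Transfinite recursion: a segment into which [B] does not embed cannot map onto [B], so every
    step finds a value not taken before. *)
Lemma le_card_of_segments (B : Type) :
  (forall x, ~ le_card B (seg lt x)) -> le_card A B.
Proof.
  intros h.
  assert (ex : forall x (g : forall y, lt y x -> B), exists b, forall y hy, g y hy <> b).
  { intros x g; apply NNPP; intros no; apply (h x).
    apply (le_card_surj (fun y : seg lt x => g (proj1_sig y) (proj2_sig y))).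
    intros b; apply NNPP; intros nb; apply no; exists b; intros y hy e; apply nb.
    exists (exist _ y hy); auto. }
  pose (F := fun x (g : forall y, lt y x -> B) =>
         proj1_sig (constructive_indefinite_description _ (ex x g))).
  pose (f := Fix swo_wf (fun _ => B) F).
  assert (hf : forall x y, lt y x -> f y <> f x).
  { intros x y hy; unfold f at 2; rewrite Fix_eq.
    - change (f y <> F x (fun z _ => f z)).
      exact (proj2_sig (constructive_indefinite_description _ (ex x (fun z _ => f z))) y hy).
    - intros z g g' e; assert (g = g') as ->; auto.
      extensionality u; extensionality v; auto. }
  exists f; intros x y e; destruct (swo_total x y) as [k|[k|k]]; auto.
  - destruct (hf _ _ k e).
  - destruct (hf _ _ k (eq_sym e)).
Qed.

Lemma le_card_segment (B : Type) : ~ le_card A B -> exists x, le_card B (seg lt x).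
Proof.
  intros h; apply NNPP; intros no; apply h, le_card_of_segments; eauto.
Qed.

Lemma segment_of_segment (x : A) (y : seg lt x) :
  le_card {z : seg lt x | lt (proj1_sig z) (proj1_sig y)} (seg lt (proj1_sig y)).
Proof.
  exists (fun z : {z : seg lt x | lt (proj1_sig z) (proj1_sig y)} =>
            exist (fun w => lt w (proj1_sig y)) (proj1_sig (proj1_sig z)) (proj2_sig z)).
  intros u v e; apply sig_inj, sig_inj; inversion e; auto.
Qed.

End WellOrder.

Lemma le_card_total (A B : Type) : le_card A B \/ le_card B A.
Proof.
  destruct (classic (le_card A B)) as [h|h]; auto; right.
  destruct (strict_well_order_exists A) as [lt wo].
  destruct (le_card_segment wo B h) as [x hx].
  eapply le_card_trans; [exact hx|apply le_card_sig].
Qed.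

Lemma not_le_lt_card (A B : Type) : ~ le_card A B -> lt_card B A.
Proof. intros h; split; auto; destruct (le_card_total A B); tauto. Qed.

Lemma not_lt_le_card (A B : Type) : ~ lt_card A B -> le_card B A.
Proof. intros h; apply NNPP; intros n; apply h, not_le_lt_card, n. Qed.

Lemma le_lt_card_trans (A B C : Type) : le_card A B -> lt_card B C -> lt_card A C.
Proof.
  intros h [h1 h2]; split; [eapply le_card_trans; eauto|].
  intros h3; apply h2; eapply le_card_trans; eauto.
Qed.

Lemma lt_le_card_trans (A B C : Type) : lt_card A B -> le_card B C -> lt_card A C.
Proof.
  intros [h1 h2] h; split; [eapply le_card_trans; eauto|].
  intros h3; apply h2; eapply le_card_trans; eauto.
Qed.

(** The order is pulled back from the least segment into which [A] embeds, if there is one; a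
    segment of full size in the new order would lead to an earlier such segment. *)
Lemma initial_order_exists (A : Type) : exists lt : A -> A -> Prop, initial_order lt.
Proof.
  destruct (strict_well_order_exists A) as [lt wo].
  destruct (classic (exists x, le_card A (seg lt x))) as [h|h].
  - destruct (swo_min wo _ h) as [x [[f hf] hmin]].
    exists (fun a b => lt (proj1_sig (f a)) (proj1_sig (f b))); split.
    + apply (swo_pullback wo (fun a => proj1_sig (f a))).
      intros a b e; apply hf, sig_inj, e.
    + intros a; apply not_le_lt_card; intros hA.
      apply (hmin _ (proj2_sig (f a))); eapply le_card_trans; [exact hA|].
      exists (fun b => exist (fun y => lt y (proj1_sig (f a))) (proj1_sig (f (proj1_sig b))) (proj2_sig b)).
      intros b c e; apply sig_inj, hf, sig_inj; inversion e; auto.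
  - exists lt; split; auto; intros x; apply not_le_lt_card; eauto.
Qed.

(** Every type smaller than [A] embeds in a proper segment of a well-order of [A], so the induction
    runs over the points of that order. *)
Lemma lt_card_wf : well_founded lt_card.
Proof.
  intros A; destruct (strict_well_order_exists A) as [lt wo].
  assert (h : forall x C, le_card C (seg lt x) -> Acc lt_card C).
  { intros x; induction x as [x IH] using (well_founded_induction (swo_wf wo)).
    intros C hC; constructor; intros D hD.
    destruct (lt_le_card_trans _ _ _ hD hC) as [_ n].
    destruct (le_card_segment (swo_pullback wo (@proj1_sig _ (fun y => lt y x))
                (fun a b => sig_inj a b)) D n) as [y hy].
    apply (IH _ (proj2_sig y)).
    eapply le_card_trans; [exact hy|apply segment_of_segment]. }
  constructor; intros D [_ n].
  destruct (le_card_segment wo D n) as [x hx]; eauto.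
Qed.

Lemma least_card (Q : CType -> Prop) (A : CType) :
  Q A -> exists C : CType, Q C /\ forall B : CType, Q B -> le_card C B.
Proof.
  induction (lt_card_wf A) as [A _ IH]; intros qA.
  destruct (classic (exists B : CType, Q B /\ lt_card B A)) as [[B [qB hB]]|no].
  - exact (IH B hB qB).
  - exists A; split; auto; intros B qB; apply not_lt_le_card; eauto.
Qed.

Lemma finite_of_not_infinite (A : Type) :
  ~ infinite_type A -> exists l : list A, forall a, In a l.
Proof.
  intros h; apply NNPP; intros no; apply h.
  assert (ex : forall l : list A, exists a, ~ In a l).
  { intros l; apply NNPP; intros n; apply no; exists l; intros a.
    apply NNPP; intros na; eauto. }
  destruct (choice_fun _ ex) as [c hc].
  pose (L := fix L n := match n with 0 => [] | S n => c (L n) :: L n end).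
  assert (hL : forall m n, m < n -> In (c (L m)) (L n)).
  { intros m n; induction n as [|n IH]; intros hmn; [lia|].
    simpl; destruct (Nat.eq_dec m n) as [->|]; auto.
    right; apply IH; lia. }
  exists (fun n => c (L n)); intros m n e.
  destruct (lt_eq_lt_dec m n) as [[k|k]|k]; auto.
  - exfalso; apply (hc (L n)); rewrite <- e; auto.
  - exfalso; apply (hc (L m)); rewrite e; auto.
Qed.

Lemma le_card_list (A : Type) (l : list A) : (forall a, In a l) -> le_card A nat.
Proof.
  intros h; destruct l as [|a0 l].
  - exists (fun _ => 0); intros x; destruct (h x).
  - apply (le_card_surj (fun n => nth n (a0 :: l) a0)).
    intros a; destruct (In_nth _ _ a0 (h a)) as [n [_ e]]; eauto.
Qed.

Lemma le_card_nat_prod : le_card (nat * nat) nat.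
Proof. exists Cantor.to_nat; apply Cantor.to_nat_inj. Qed.

Lemma infinite_le (A B : Type) : infinite_type A -> le_card A B -> infinite_type B.
Proof. apply le_card_trans. Qed.

Lemma infinite_remove (A : Type) (a : A) : infinite_type A -> infinite_type {b | b <> a}.
Proof.
  intros [f hf].
  destruct (classic (exists n, f n = a)) as [[n hn]|no].
  - assert (h : forall k, f (S n + k) <> a).
    { intros k e; rewrite <- hn in e; apply hf in e; lia. }
    exists (fun k => exist _ (f (S n + k)) (h k)).
    intros x y e; inversion e as [e']; apply hf in e'; lia.
  - assert (h : forall k, f k <> a) by eauto.
    exists (fun k => exist _ (f k) (h k)); intros x y e; inversion e; auto.
Qed.

(** Hilbert's hotel: [None] goes to [f 0], the copy of [nat] moves up by one, everything else
    stays. *)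
Lemma infinite_option (A : Type) : infinite_type A -> le_card (option A) A.
Proof.
  intros [f hf].
  assert (ex : forall o : option A, exists b,
    (o = None -> b = f 0) /\
    forall a, o = Some a -> (forall n, a = f n -> b = f (S n)) /\ ((forall n, a <> f n) -> b = a)).
  { intros [a|].
    - destruct (classic (exists n, a = f n)) as [[n hn]|no].
      + exists (f (S n)); split; [discriminate|]; intros a' e; inversion e; subst a'; split.
        * intros m hm; rewrite hn in hm; apply hf in hm; congruence.
        * intros hm; destruct (hm n hn).
      + exists a; split; [discriminate|]; intros a' e; inversion e; subst a'; split; auto.
        intros n hn; exfalso; eauto.
    - exists (f 0); split; auto; discriminate. }
  destruct (choice_fun _ ex) as [g hg]; exists g.
  assert (hN : g None = f 0) by exact (proj1 (hg None) eq_refl).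
  assert (hS : forall n, g (Some (f n)) = f (S n)).
  { intros n; exact (proj1 (proj2 (hg (Some (f n))) _ eq_refl) n eq_refl). }
  assert (hO : forall a, (forall n, a <> f n) -> g (Some a) = a).
  { intros a h; exact (proj2 (proj2 (hg (Some a)) _ eq_refl) h). }
  assert (cases : forall o, (o = None) \/ (exists n, o = Some (f n)) \/
                            (exists a, o = Some a /\ forall n, a <> f n)).
  { intros [a|]; auto; right.
    destruct (classic (exists n, a = f n)) as [[n ->]|no]; eauto.
    right; exists a; split; auto; intros n e; eauto. }
  intros x y; destruct (cases x) as [->|[[n ->]|[a [-> ha]]]];
    destruct (cases y) as [->|[[m ->]|[b [-> hb]]]];
    rewrite ?hN, ?hS, ?(hO _ ha), ?(hO _ hb); intros e; auto.
  - apply hf in e; discriminate.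
  - destruct (hb _ (eq_sym e)).
  - apply hf in e; discriminate.
  - apply hf in e; congruence.
  - destruct (hb _ (eq_sym e)).
  - destruct (ha _ e).
  - destruct (ha _ e).
  - congruence.
Qed.

(** With a maximum [x], [A] would be one point more than an infinite segment, hence no larger than
    it. *)
Lemma initial_no_max {A : Type} {lt : A -> A -> Prop} :
  initial_order lt -> infinite_type A -> forall x, exists y, lt x y.
Proof.
  intros [wo hs] inf x; apply NNPP; intros no.
  assert (h : forall y, y <> x -> lt y x).
  { intros y ne; destruct (swo_total wo y x) as [k|[k|k]]; auto; [contradiction|].
    destruct no; eauto. }
  apply (hs x).
  assert (hseg : infinite_type (seg lt x)).
  { apply (infinite_le {b | b <> x}); [apply infinite_remove; auto|].
    apply le_card_sub, h. }
  eapply le_card_trans; [|apply (infinite_option _ hseg)].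
  apply (le_card_surj (fun o : option (seg lt x) =>
           match o with None => x | Some y => proj1_sig y end)).
  intros a; destruct (classic (a = x)) as [->|ne].
  - exists None; auto.
  - exists (Some (exist _ a (h a ne))); auto.
Qed.

Lemma initial_le_segment {A : Type} {lt : A -> A -> Prop} :
  initial_order lt -> infinite_type A -> forall x, lt_card {y | ~ lt x y} A.
Proof.
  intros ini inf x; destruct (initial_no_max ini inf x) as [z hz].
  apply (le_lt_card_trans _ (seg lt z)); [|apply ini].
  apply le_card_sub; intros y hy; eapply swo_le_lt; eauto; apply ini.
Qed.

Lemma initial_list_bound {A : Type} {lt : A -> A -> Prop} :
  initial_order lt -> infinite_type A ->
  forall l : list A, exists b, forall a, In a l -> lt a b.
Proof.
  intros ini inf; induction l as [|a l [b hb]].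
  - destruct inf as [f _]; exists (f 0); intros a [].
  - destruct (initial_no_max ini inf a) as [b1 h1].
    destruct (swo_total (proj1 ini) b b1) as [k|[k|k]].
    + exists b1; intros c [->|hc]; auto; eapply swo_trans; eauto; apply ini.
    + subst b1; exists b; intros c [->|hc]; auto.
    + exists b; intros c [->|hc]; auto; eapply swo_trans; eauto; apply ini.
Qed.

(* Order [A * A] by the maximum of the two coordinates, ties broken arbitrarily:
   every proper initial segment lies in the square of a proper initial segment of [A]. *)
Lemma square_step {A : Type} {lt : A -> A -> Prop} :
  initial_order lt -> infinite_type A -> ~ le_card A nat ->
  (forall y, infinite_type (seg lt y) -> le_card (seg lt y * seg lt y) (seg lt y)) ->
  le_card (A * A) A.
Proof.
  intros ini inf unc IH; destruct ini as [wo hs]; pose proof (conj wo hs : initial_order lt) as ini.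
  assert (hm : exists m0, infinite_type (seg lt m0)) by (apply (le_card_segment wo nat unc)).
  destruct hm as [m0 hm0].
  assert (ex : forall p : A * A, exists m, (m = fst p \/ m = snd p) /\ ~ lt m (fst p) /\ ~ lt m (snd p)).
  { intros [a b]; simpl; destruct (swo_total wo a b) as [k|[<-|k]].
    - exists b; repeat split; auto; [apply (swo_asym wo), k|apply (swo_irrefl wo)].
    - exists a; repeat split; auto; apply (swo_irrefl wo).
    - exists a; repeat split; auto; [apply (swo_irrefl wo)|apply (swo_asym wo), k]. }
  destruct (choice_fun _ ex) as [mx hmx].
  destruct (strict_well_order_exists (A * A)) as [lt2 wo2].
  apply (le_card_of_segments (swo_lex wo mx lt2 wo2)).
  intros p hp.
  (* Bounding [m0] as well makes the segment below [m] infinite, as the hypothesis on segments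
     requires. *)
  destruct (initial_list_bound ini inf [mx p; m0]) as [m hm].
  assert (hseg : infinite_type (seg lt m)).
  { eapply infinite_le; [exact hm0|].
    apply le_card_sub; intros y hy; eapply swo_trans; eauto; apply hm; simpl; auto. }
  apply (hs m), (le_card_trans _ _ _ hp).
  eapply le_card_trans; [|apply (IH m hseg)].
  assert (hq : forall q, lt (mx q) (mx p) \/ mx q = mx p /\ lt2 q p -> lt (mx q) m).
  { assert (lt (mx p) m) by (apply hm; simpl; auto).
    intros q [h|[-> _]]; auto; eapply swo_trans; eauto. }
  exists (fun q => (exist (fun y => lt y m) (fst (proj1_sig q))
                      (swo_le_lt wo _ _ _ (proj1 (proj2 (hmx (proj1_sig q)))) (hq _ (proj2_sig q))),
                    exist (fun y => lt y m) (snd (proj1_sig q))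
                      (swo_le_lt wo _ _ _ (proj2 (proj2 (hmx (proj1_sig q)))) (hq _ (proj2_sig q))))).
  intros [[a b] h] [[a' b'] h'] e; apply sig_inj; simpl in *; inversion e; auto.
Qed.

Lemma le_card_square (A : Type) : infinite_type A -> le_card (A * A) A.
Proof.
  induction (lt_card_wf A) as [A _ IH]; intros inf.
  destruct (classic (le_card A nat)) as [h|h].
  - eapply le_card_trans; [apply (le_card_prod _ _ _ _ h h)|].
    eapply le_card_trans; [apply le_card_nat_prod|exact inf].
  - destruct (initial_order_exists A) as [lt ini].
    apply (square_step ini inf h); intros y hy; apply IH; auto; apply ini.
Qed.

Lemma le_card_nat_prod_infinite (A : Type) : infinite_type A -> le_card (nat * A) A.
Proof.
  intros inf; eapply le_card_trans; [|apply le_card_square, inf].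
  apply le_card_prod; [exact inf|apply le_card_refl].
Qed.

Lemma lt_card_prod (A B K : Type) :
  ~ le_card K nat -> lt_card A K -> lt_card B K -> lt_card (A * B) K.
Proof.
  intros unc hA hB; apply not_le_lt_card; intros hK.
  assert (key : forall C : Type, lt_card C K -> ~ le_card K (C * C)).
  { intros C hC h; destruct (classic (infinite_type C)) as [i|n].
    - apply hC; eapply le_card_trans; [exact h|apply le_card_square, i].
    - apply unc; destruct (le_card_total nat C) as [i|hn]; [contradiction|].
      eapply le_card_trans; [exact h|].
      eapply le_card_trans; [apply (le_card_prod _ _ _ _ hn hn)|apply le_card_nat_prod]. }
  destruct (le_card_total A B) as [h|h].
  - apply (key B hB); eapply le_card_trans; [exact hK|].
    apply le_card_prod; [exact h|apply le_card_refl].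
  - apply (key A hA); eapply le_card_trans; [exact hK|].
    apply le_card_prod; [apply le_card_refl|exact h].
Qed.

Lemma le_card_sigma (D : Type) (A : D -> Type) (B : Type) :
  (forall d, le_card (A d) B) -> le_card {d & A d} (D * B).
Proof.
  intros h; destruct (choice_dep _ h) as [f hf].
  exists (fun p => (projT1 p, f (projT1 p) (projT2 p))).
  intros [d a] [d' a'] e; simpl in e; inversion e as [[e1 e2]]; subst d'.
  apply hf in e2; subst; auto.
Qed.

Lemma lt_card_power (A : Type) : lt_card A (A -> Prop).
Proof.
  split.
  - exists (fun a b => a = b); intros a b e.
    rewrite (f_equal (fun w => w b) e); auto.
  - intros h; destruct (le_card_surj_inv _ _ h (inhabits (fun _ => True))) as [g hg].
    destruct (hg (fun a => ~ g a a)) as [a ha].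
    pose proof (f_equal (fun w => w a) ha) as e; simpl in e.
    assert (n : ~ g a a) by (intros n; pose proof n as n'; rewrite e in n'; auto).
    apply n; rewrite e; exact n.
Qed.

Lemma le_card_nat_power (A : Type) :
  infinite_type A -> le_card (nat -> A -> Prop) (A -> Prop).
Proof.
  intros inf; eapply le_card_trans; [|apply le_card_pow, le_card_nat_prod_infinite, inf].
  exists (fun f p => f (fst p) (snd p)); intros f g e.
  extensionality n; extensionality a; exact (f_equal (fun w => w (n, a)) e).
Qed.

Lemma le_card_seq_power (A : Type) : infinite_type A -> le_card (nat -> A) (A -> Prop).
Proof.
  intros inf; eapply le_card_trans; [|apply le_card_nat_power, inf].
  apply le_card_fun, lt_card_power.
Qed.

Lemma gch_power (A B : CType) :
  GCH -> infinite_type A -> lt_card A B -> le_card (A -> Prop) B.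
Proof.
  intros gch inf h; apply not_lt_le_card; intros h'; exact (gch A B inf (conj h h')).
Qed.

(** * Ideals of small cardinals and cofinality *)

(** [small_seq] is the decisive clause: a small set has only small many countable sequences, so
    adding something small for each of them keeps it small. *)
Record small_ideal (small : CType -> Prop) : Prop := {
  small_le : forall A B : CType, le_card A B -> small B -> small A;
  small_seq : forall A : CType, small A -> small (nat -> A);
  small_sigma : forall (D : CType) (A : D -> CType),
      small D -> (forall d, small (A d)) -> small {d & A d};
  small_nat : small nat }.

Section Small.
Context {small : CType -> Prop} (si : small_ideal small).

Lemma small_image {D T : CType} (f : D -> T) (A : T -> Prop) :
  small D -> (forall v, A v -> exists d, f d = v) -> small {v | A v}.
Proof.
  intros sD h; apply (small_le _ si _ D); auto.
  assert (h' : forall v : {v | A v}, exists d, f d = proj1_sig v) by (intros [v hv]; auto).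
  destruct (choice_fun _ h') as [g hg]; exists g; intros x y e.
  apply sig_inj; rewrite <- (hg x), <- (hg y), e; auto.
Qed.

Lemma small_sub {T : CType} (A B : T -> Prop) :
  (forall v, A v -> B v) -> small {v | B v} -> small {v | A v}.
Proof. intros h; apply (small_le _ si), le_card_sub, h. Qed.

Lemma small_prod (A B : CType) : small A -> small B -> small (A * B)%type.
Proof.
  intros hA hB; apply (small_le _ si _ {_ : A & B}); [|apply (small_sigma _ si); auto].
  exists (fun p => existT (fun _ => B) (fst p) (snd p)); intros [a b] [a' b'] e.
  inversion e; auto.
Qed.

Lemma small_union {T I : CType} (A : I -> T -> Prop) :
  small I -> (forall i, small {v | A i v}) -> small {v | exists i, A i v}.
Proof.
  intros sI h.
  apply (small_image (fun p : {i & {v | A i v}} => proj1_sig (projT2 p))).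
  - apply (small_sigma _ si); auto.
  - intros v [i hi]; exists (existT _ i (exist _ v hi)); auto.
Qed.

Lemma small_countable {T : CType} (e : nat -> T) (A : T -> Prop) :
  (forall v, A v -> exists n, e n = v) -> small {v | A v}.
Proof. apply small_image, (small_nat _ si). Qed.

Lemma small_or {T : CType} (A B : T -> Prop) :
  small {v | A v} -> small {v | B v} -> small {v | A v \/ B v}.
Proof.
  intros hA hB.
  apply (small_sub _ (fun v => exists b : bool, if b then A v else B v)).
  - intros v [h|h]; [exists true|exists false]; auto.
  - apply small_union.
    + apply (small_le _ si _ nat); [|apply (small_nat _ si)].
      apply (le_card_list _ [true; false]); intros []; simpl; auto.
    + intros []; auto.
Qed.

Lemma small_list {T : CType} (l : list T) : small {v | In v l}.
Proof.
  destruct l as [|a l].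
  - apply (small_le _ si _ nat); [|apply (small_nat _ si)].
    exists (fun _ => 0); intros [x []].
  - apply (small_countable (fun n => nth n (a :: l) a)).
    intros v hv; destruct (In_nth _ _ a hv) as [n [_ e]]; eauto.
Qed.

Lemma not_small_diff {T : CType} (A B : T -> Prop) :
  ~ small {v | A v} -> small {v | B v} -> ~ small {v | A v /\ ~ B v}.
Proof.
  intros hA hB h; apply hA.
  apply (small_sub _ (fun v => (A v /\ ~ B v) \/ B v)).
  - intros v hv; destruct (classic (B v)); auto.
  - apply small_or; auto.
Qed.

Lemma not_small_inhabited {T : CType} (A : T -> Prop) : ~ small {v | A v} -> exists v, A v.
Proof.
  intros h; apply NNPP; intros no; apply h.
  apply (small_le _ si _ nat); [|apply (small_nat _ si)].
  exists (fun _ => 0); intros [x hx]; destruct no; eauto.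
Qed.

End Small.

(** Closure under countable powers is $(2^B)^\omega = 2^{\omega\times B} = 2^B$. *)
Lemma small_ideal_power (B : CType) :
  infinite_type B -> small_ideal (fun A => le_card A (B -> Prop)).
Proof.
  intros inf; set (N := B -> Prop).
  assert (infN : infinite_type N) by (eapply infinite_le; [exact inf|apply lt_card_power]).
  split.
  - intros A A' h1 h2; eapply le_card_trans; eauto.
  - intros A h; eapply le_card_trans; [apply (le_card_fun nat _ _ h)|].
    apply le_card_nat_power, inf.
  - intros D A hD hA; eapply le_card_trans; [apply (le_card_sigma _ _ _ hA)|].
    eapply le_card_trans; [|apply (le_card_square N infN)].
    apply le_card_prod; [exact hD|apply le_card_refl].
  - exact infN.
Qed.

(** In a sum over a small [D] each summand embeds in a proper segment of [C]. Regularity puts these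
    segments inside a single one, and a product of two types smaller than [C] is smaller than
    [C]. *)
Lemma small_ideal_regular (C : CType) (ltC : C -> C -> Prop) :
  initial_order ltC -> ~ le_card C nat ->
  (forall (D : CType) (g : D -> C), lt_card D C -> exists b, forall d, ltC (g d) b) ->
  (forall A : CType, lt_card A C -> lt_card (nat -> A) C) ->
  small_ideal (fun A => lt_card A C).
Proof.
  intros [wo hini] unc reg good; split.
  - intros A B; apply le_lt_card_trans.
  - exact good.
  - intros D A hD hA.
    assert (h : forall d, exists c, le_card (A d) (seg ltC c)).
    { intros d; apply (le_card_segment wo), hA. }
    destruct (choice_fun _ h) as [s hs].
    destruct (reg D s hD) as [b hb].
    apply (le_lt_card_trans _ (D * seg ltC b)).
    + apply le_card_sigma; intros d; eapply le_card_trans; [apply hs|].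
      apply le_card_sub; intros y hy; eapply swo_trans; eauto.
    + apply lt_card_prod; auto.
  - apply not_le_lt_card, unc.
Qed.

Lemma cofinal_infinite (K : CType) (lt : K -> K -> Prop) (D : CType) (g : D -> K) :
  initial_order lt -> infinite_type K ->
  cofinal lt (fun k => exists d, g d = k) -> infinite_type D.
Proof.
  intros ini inf cof; apply NNPP; intros fin.
  destruct (finite_of_not_infinite _ fin) as [l hl].
  destruct (initial_list_bound ini inf (map g l)) as [b hb].
  destruct (cof b) as [k [[d <-] hk]]; apply hk, hb, in_map, hl.
Qed.

(** A cofinal map from a least possible type is replaced by the inclusion of its range, because
    [cf_is] asks for an injective one. *)
Lemma cofinality_exists (K : CType) (lt : K -> K -> Prop) :
  strict_well_order lt ->
  exists (C : CType) (f : C -> K), (forall x y, f x = f y -> x = y) /\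
    cofinal lt (fun k => exists c, f c = k) /\
    (forall (D : CType) (g : D -> K),
        cofinal lt (fun k => exists d, g d = k) -> le_card C D).
Proof.
  intros wo.
  destruct (least_card (fun D : CType => exists g : D -> K,
    cofinal lt (fun k => exists d, g d = k)) K) as [C [[g hg] hmin]].
  { exists (fun k => k); intros x; exists x; split; [eauto|apply (swo_irrefl wo)]. }
  exists {k | exists c, g c = k}, (@proj1_sig _ _); split; [|split].
  - apply sig_inj.
  - intros x; destruct (hg x) as [k [hk hx]]; exists k; split; auto.
    exists (exist _ k hk); auto.
  - intros D h hh; apply (le_card_trans _ C); [|eauto].
    assert (ex : forall k : {k | exists c, g c = k}, exists c, g c = proj1_sig k) by (intros [k hk]; auto).
    destruct (choice_fun _ ex) as [s hs]; exists s; intros x y e.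
    apply sig_inj; rewrite <- (hs x), <- (hs y), e; auto.
Qed.

Section Cofinality.
Context {K C : CType} {lt : K -> K -> Prop} {f : C -> K} {ltC : C -> C -> Prop}.
Context (ini : initial_order lt) (inf : infinite_type K)
  (cof : cofinal lt (fun k => exists c, f c = k))
  (min : forall (D : CType) (g : D -> K),
      cofinal lt (fun k => exists d, g d = k) -> le_card C D)
  (iniC : initial_order ltC).

Lemma cofinality_initial_bounded c : exists x, forall c', ~ ltC c c' -> lt (f c') x.
Proof.
  assert (infC : infinite_type C) by exact (cofinal_infinite K lt C f ini inf cof).
  apply NNPP; intros no.
  apply (initial_le_segment iniC infC c).
  apply (min {c' | ~ ltC c c'} (fun c' => f (proj1_sig c'))).
  intros x; apply NNPP; intros nx; apply no; exists x; intros c' hc'.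
  apply NNPP; intros n; apply nx; exists (f c'); split; auto.
  exists (exist _ c' hc'); auto.
Qed.

(** [f] need not be monotone, so it is replaced by [B c], a strict bound for [f] on everything up to
    [c]. If [g] were unbounded in [C], the values [B (g d)] would be cofinal in [K]. *)
Lemma cofinality_regular (D : CType) (g : D -> C) :
  lt_card D C -> exists b, forall d, ltC (g d) b.
Proof.
  destruct (choice_fun _ cofinality_initial_bounded) as [B hB].
  intros hD; apply NNPP; intros no; apply hD.
  apply (min D (fun d => B (g d))); intros x.
  destruct (cof x) as [k [[c <-] hc]].
  assert (hd : exists d, ~ ltC (g d) c).
  { apply NNPP; intros n; apply no; exists c; intros d; apply NNPP; eauto. }
  destruct hd as [d hd]; exists (B (g d)); split; eauto.
  intros h; apply hc; eapply (swo_trans (proj1 ini)); [apply (hB (g d) c hd)|exact h].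
Qed.

Lemma gch_le_of_lt (A B : CType) :
  GCH -> infinite_type A -> le_card K (A -> Prop) -> lt_card B K -> le_card B A.
Proof.
  intros gch infA hK hB; apply NNPP; intros n; apply hB.
  eapply le_card_trans; [exact hK|].
  apply gch_power; auto; apply not_le_lt_card, n.
Qed.

(** If $2^A$ reached [K], then by GCH every cardinal below [K], that of [C] included, would be at
    most [A]; as a union of [C] many closed initial segments, [K] would be at most $A\times A$. *)
Lemma gch_singular_strong_limit (A : CType) :
  GCH -> lt_card C K -> infinite_type A -> lt_card A K -> lt_card (A -> Prop) K.
Proof.
  intros gch hC infA hA; apply not_le_lt_card; intros hK; apply hA.
  pose proof (fun B => gch_le_of_lt A B gch infA hK) as small.
  apply (le_card_trans _ {c : C & {x | ~ lt (f c) x}}).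
  - apply (le_card_surj (fun p : {c : C & {x | ~ lt (f c) x}} => proj1_sig (projT2 p))).
    intros x; destruct (cof x) as [k [[c <-] hc]].
    exists (existT (fun c => {x | ~ lt (f c) x}) c (exist _ x hc)); auto.
  - eapply le_card_trans.
    + apply (le_card_sigma _ _ A); intros c; apply small, (initial_le_segment ini inf).
    + eapply le_card_trans; [|apply (le_card_square A infA)].
      apply le_card_prod; [apply small, hC|apply le_card_refl].
Qed.

End Cofinality.

Lemma cf_is_nat_countable (A : CType) : infinite_type A -> le_card A nat -> cf_is A nat.
Proof.
  intros inf h; destruct (cantor_bernstein _ _ inf h) as [e [inj surj]].
  destruct (initial_order_exists A) as [lt ini].
  exists lt; split; auto; split.
  - exists e; split; auto; intros x; exists x; split; auto.
    apply (swo_irrefl (proj1 ini)).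
  - intros D g; apply (cofinal_infinite A lt); auto.
Qed.

(** For injectivity [s] is replaced by a strictly increasing sequence [g] with [g (S n)] above
    [s n]. *)
Lemma cf_is_nat_cofinal (A : CType) (lt : A -> A -> Prop) (s : nat -> A) :
  infinite_type A -> initial_order lt -> cofinal lt (fun k => exists n, s n = k) -> cf_is A nat.
Proof.
  intros inf ini cof; exists lt; split; auto.
  assert (ex : forall p : nat * A, exists b, lt (snd p) b /\ lt (s (fst p)) b).
  { intros [n a]; destruct (initial_list_bound ini inf [a; s n]) as [b hb].
    exists b; split; apply hb; simpl; auto. }
  destruct (choice_fun _ ex) as [nx hnx].
  pose (g := fix g n := match n with 0 => s 0 | S n => nx (n, g n) end).
  assert (hg : forall m n, m < n -> lt (g m) (g n)).
  { intros m n h; induction h as [|n h IH].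
    - apply (hnx (m, g m)).
    - eapply (swo_trans (proj1 ini)); [exact IH|apply (hnx (n, g n))]. }
  split.
  - exists g; split.
    + intros m n e; destruct (lt_eq_lt_dec m n) as [[k|k]|k]; auto;
        apply hg in k; rewrite e in k; destruct (swo_irrefl (proj1 ini) _ k).
    + intros x; destruct (cof x) as [k [[n <-] hn]]; exists (g (S n)); split; eauto.
      intros h; apply hn; eapply (swo_trans (proj1 ini)); [apply (hnx (n, g n))|exact h].
  - intros D h; apply (cofinal_infinite A lt); auto.
Qed.

(** This is $\max(|A|,\omega)$: the power estimates want an infinite type, but a segment of a
    well-order may be finite. *)
Lemma infinite_hull (A : CType) :
  exists B : CType, le_card A B /\ infinite_type B /\
    forall C : CType, lt_card A C -> lt_card nat C -> lt_card B C.
Proof.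
  destruct (classic (infinite_type A)) as [i|n].
  - exists A; split; [apply le_card_refl|auto].
  - exists nat; split; [|split; [apply le_card_refl|auto]].
    destruct (le_card_total nat A); tauto.
Qed.

(** Every sequence is bounded, so $A^\omega$ is the union, over [a], of the sequences in the segment
    below [a]. These number at most $2^\mu$ for some infinite $\mu<|A|$, hence at most $|A|$ by
    GCH. *)
Lemma gch_seq_le (A : CType) :
  GCH -> infinite_type A -> ~ cf_is A nat -> le_card (nat -> A) A.
Proof.
  intros gch inf ncf.
  assert (unc : lt_card nat A).
  { apply not_le_lt_card; intros h; apply ncf, cf_is_nat_countable; auto. }
  destruct (initial_order_exists A) as [lt ini].
  assert (bd : forall s : nat -> A, exists b, forall n, lt (s n) b).
  { intros s; apply NNPP; intros no; apply ncf, (cf_is_nat_cofinal A lt s inf ini).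
    intros x; apply NNPP; intros nx; apply no; exists x; intros n; apply NNPP; intros k.
    apply nx; exists (s n); eauto. }
  destruct (choice_fun _ bd) as [b hb].
  apply (le_card_trans _ {a : A & nat -> seg lt a}).
  - apply (le_card_surj (fun p : {a : A & nat -> seg lt a} => fun n => proj1_sig (projT2 p n))).
    intros s; exists (existT (fun a => nat -> seg lt a) (b s) (fun n => exist _ (s n) (hb s n))); auto.
  - eapply le_card_trans; [apply (le_card_sigma _ _ A)|apply (le_card_square A inf)].
    intros a; destruct (infinite_hull (seg lt a)) as [B [h1 [h2 h3]]].
    eapply le_card_trans; [apply (le_card_fun nat _ _ h1)|].
    eapply le_card_trans; [apply (le_card_seq_power B h2)|].
    apply gch_power; auto; apply h3; auto; apply ini.
Qed.

(* If [A < C <= A^omega] then [C] is the successor of [A] by GCH,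
   and the hypothesis on [K] excludes exactly the case [cf A = omega]. *)
Lemma gch_cofinality_closed (K C A : CType) :
  GCH -> ~ cf_succ_of_cof_omega K -> cf_is K C -> ~ le_card C nat ->
  lt_card A C -> lt_card (nat -> A) C.
Proof.
  intros gch hK cf unc hA.
  destruct (infinite_hull A) as [B [h1 [h2 h3]]].
  assert (hB : lt_card B C) by (apply h3; auto; apply not_le_lt_card, unc).
  apply (le_lt_card_trans _ (nat -> B)); [apply le_card_fun, h1|].
  apply not_le_lt_card; intros hC.
  assert (hP : le_card C (B -> Prop)).
  { eapply le_card_trans; [exact hC|apply le_card_seq_power, h2]. }
  apply hB, (le_card_trans _ _ _ hC), gch_seq_le; auto.
  intros cfB; apply hK; exists C, B; split; auto; split; auto; split; auto.
  intros D hD; eapply le_card_trans; [exact hP|apply gch_power; auto].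
Qed.

(** * Connectivity, disjoint paths and rays *)

Arguments on_ray {V}.
Arguments first_vertex {V}.
Arguments last_vertex {V}.
Arguments disjoint_paths {V}.
Arguments walk {V}.
Arguments is_ray {V}.
Arguments is_path {V}.
Arguments AB_path {V}.
Arguments equiv_rays {V}.
Arguments disjoint_ray_family {V I}.

Lemma history_choice {T : Type} (Phi : nat -> list T -> T -> Prop) :
  (forall n l, exists t, Phi n l t) ->
  exists (s : nat -> T) (L : nat -> list T),
    forall n, Phi n (L n) (s n) /\ forall m, m < n -> In (s m) (L n).
Proof.
  intros h.
  destruct (choice_fun (fun p t => Phi (fst p) (snd p) t)) as [c hc].
  { intros [n l]; apply h. }
  pose (L := fix L n := match n with 0 => [] | S n => c (n, L n) :: L n end).
  exists (fun n => c (n, L n)), L; intros n; split; [apply (hc (n, L n))|].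
  intros m hm; induction hm as [|n hm IH]; simpl; auto.
Qed.

Lemma eventually_avoid {V : Type} (B : nat -> V -> Prop) :
  (forall m n v, B m v -> B n v -> m = n) ->
  forall X : list V, exists N, forall n, N <= n -> forall v, B n v -> ~ In v X.
Proof.
  intros h; induction X as [|x X [N hN]].
  - exists 0; intros n _ v _ [].
  - destruct (classic (exists m, B m x)) as [[m hm]|no].
    + exists (max N (S m)); intros n hn v hv [<-|hx].
      * pose proof (h _ _ _ hm hv); lia.
      * apply (hN n) with v; auto; lia.
    + exists N; intros n hn v hv [<-|hx]; eauto.
      eapply hN; eauto.
Qed.

Lemma injective_escapes {V : Type} (W : nat -> V) :
  (forall m n, W m = W n -> m = n) -> forall Y : list V, exists n, ~ In (W n) Y.
Proof.
  intros inj Y; destruct (eventually_avoid (fun n v => W n = v)) with (X := Y) as [N hN].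
  - intros m n v h1 h2; apply inj; congruence.
  - exists N; eapply hN; eauto.
Qed.

Section Lists.
Context {V : Type}.

Lemma first_vertex_in (p : list V) x : first_vertex p x -> In x p.
Proof. destruct p; intros h; inversion h; simpl; auto. Qed.

Lemma last_vertex_in (p : list V) x : last_vertex p x -> In x p.
Proof. intros h; apply in_rev; apply first_vertex_in; auto. Qed.

Lemma first_vertex_eq (p : list V) x y : first_vertex p x -> first_vertex p y -> x = y.
Proof. unfold first_vertex; congruence. Qed.

Lemma last_vertex_eq (p : list V) x y : last_vertex p x -> last_vertex p y -> x = y.
Proof. unfold last_vertex; congruence. Qed.

Lemma last_vertex_snoc (l : list V) y : last_vertex (l ++ [y]) y.
Proof. unfold last_vertex; rewrite rev_app_distr; reflexivity. Qed.

Lemma first_vertex_app (l1 l2 l3 : list V) v x :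
  first_vertex (l1 ++ v :: l2) x -> first_vertex (l1 ++ v :: l3) x.
Proof. destruct l1; auto. Qed.

Lemma last_vertex_app (l1 l2 : list V) v y :
  last_vertex (l1 ++ v :: l2) y <-> last_vertex (v :: l2) y.
Proof.
  unfold last_vertex; rewrite rev_app_distr.
  assert (h : rev (v :: l2) <> []) by (simpl; intros e; destruct (app_cons_not_nil _ _ _ (eq_sym e))).
  destruct (rev (v :: l2)); [congruence|reflexivity].
Qed.

End Lists.

Section Graph.
Context {V : Type} {adj : V -> V -> Prop} (adj_sym : forall x y, adj x y -> adj y x).

Lemma walk_app (l1 l2 : list V) v :
  walk adj (l1 ++ v :: l2) <-> walk adj (l1 ++ [v]) /\ walk adj (v :: l2).
Proof.
  induction l1 as [|a l1 IH].
  - simpl; tauto.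
  - destruct l1 as [|b l1].
    + simpl; tauto.
    + change (adj a b /\ walk adj ((b :: l1) ++ v :: l2) <->
              (adj a b /\ walk adj ((b :: l1) ++ [v])) /\ walk adj (v :: l2)).
      rewrite IH; tauto.
Qed.

(** Connection inside [S] is kept as a transitive relation, so that routes can be glued without
    regard to repetitions; [AB_path_of_reach] extracts a genuine path at the end. *)
Inductive reach (S : V -> Prop) : V -> V -> Prop :=
| reach_refl x : S x -> reach S x x
| reach_step x y z : S x -> adj x y -> reach S y z -> reach S x z.

Lemma reach_trans S x y z : reach S x y -> reach S y z -> reach S x z.
Proof. intros h; induction h; auto; intros; eapply reach_step; eauto. Qed.

Lemma reach_start S x y : reach S x y -> S x.
Proof. intros h; destruct h; auto. Qed.

Lemma reach_sym S x y : reach S x y -> reach S y x.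
Proof.
  intros h; induction h as [x h|x y z hx ha h IH]; [constructor; auto|].
  eapply reach_trans; [exact IH|].
  eapply reach_step; [eapply reach_start; eauto|apply adj_sym, ha|constructor; auto].
Qed.

Lemma reach_mono (S S' : V -> Prop) x y :
  (forall v, S v -> S' v) -> reach S x y -> reach S' x y.
Proof. intros hs h; induction h; [constructor; auto|eapply reach_step; eauto]. Qed.

Lemma walk_reach_first (S : V -> Prop) l x :
  walk adj (x :: l) -> (forall v, In v (x :: l) -> S v) -> forall v, In v (x :: l) -> reach S x v.
Proof.
  revert x; induction l as [|y l IH]; intros x hw hS v hv.
  - destruct hv as [->|[]]; constructor; apply hS; simpl; auto.
  - destruct hv as [->|hv]; [constructor; apply hS; simpl; auto|].
    destruct hw as [ha hw]; eapply reach_step; [apply hS; simpl; auto|exact ha|].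
    apply IH; auto; intros w hw'; apply hS; simpl in *; auto.
Qed.

Lemma walk_reach (S : V -> Prop) p u v :
  walk adj p -> (forall w, In w p -> S w) -> In u p -> In v p -> reach S u v.
Proof.
  destruct p as [|x l]; [intros _ _ []|]; intros hw hS hu hv.
  eapply reach_trans; [apply reach_sym|]; eapply walk_reach_first; eauto.
Qed.

Lemma reach_walk (S : V -> Prop) x y : reach S x y ->
  exists l, walk adj (x :: l) /\ last_vertex (x :: l) y /\ forall v, In v (x :: l) -> S v.
Proof.
  intros h; induction h as [x h|x y z hx ha h [l [h1 [h2 h3]]]].
  - exists []; repeat split; auto; intros v [<-|[]]; auto.
  - exists (y :: l); repeat split; auto.
    + apply (last_vertex_app [x]), h2.
    + intros v [<-|hv]; auto.
Qed.

(** A shortest walk from [A] to [B] in [S] will do: a repeated vertex, or a further vertex of [A] or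
    [B], would allow a loop or an end piece to be cut off. *)
Lemma AB_path_of_reach (S A B : V -> Prop) a b :
  A a -> B b -> reach S a b ->
  exists p, AB_path adj A B p /\ forall v, In v p -> S v.
Proof.
  intros hA hB hr.
  pose (good := fun p => walk adj p /\ (forall v, In v p -> S v) /\
          (exists x, first_vertex p x /\ A x) /\ (exists y, last_vertex p y /\ B y)).
  assert (ex : exists p, good p).
  { destruct (reach_walk _ _ _ hr) as [l [h1 [h2 h3]]]; exists (a :: l).
    repeat split; auto; [exists a|exists b]; split; auto; reflexivity. }
  assert (mn : exists p, good p /\ forall q, good q -> length p <= length q).
  { destruct ex as [p hp]; remember (length p) as n eqn:hn; revert p hn hp.
    induction n as [n IH] using lt_wf_ind; intros p hn hp.
    destruct (classic (exists q, good q /\ length q < n)) as [[q [hq hl]]|no].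
    - eapply (IH _ hl q); auto.
    - exists p; split; auto; intros q hq.
      destruct (le_lt_dec (length p) (length q)); auto; destruct no; exists q; split; auto; lia. }
  destruct mn as [p [[hw [hS [[x [fx Ax]] [y [ly By]]]]] hmin]].
  exists p; split; auto; split.
  - split; [intros ->; inversion fx|split; auto].
    apply NNPP; intros nd.
    destruct (not_NoDup (fun u v => classic (u = v)) nd) as [v [l1 [l2 [l3 e]]]]; subst p.
    assert (h : length (l1 ++ v :: l2 ++ v :: l3) <= length (l1 ++ v :: l3)).
    { apply hmin; repeat split.
      - apply walk_app; apply walk_app in hw; destruct hw as [h1 h2]; split; auto.
        exact (proj2 (proj1 (walk_app (v :: l2) l3 v) h2)).
      - intros w hw'; apply hS; rewrite !in_app_iff in *; simpl in *; rewrite in_app_iff; simpl; tauto.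
      - exists x; split; auto; eapply first_vertex_app, fx.
      - exists y; split; auto; apply last_vertex_app; apply last_vertex_app in ly.
        exact (proj1 (last_vertex_app (v :: l2) l3 v y) ly). }
    rewrite !length_app in h; simpl in h; rewrite length_app in h; simpl in h; lia.
  - exists x, y; do 4 (split; auto); split.
    + intros v hv Av; apply in_split in hv; destruct hv as [l1 [l2 ->]].
      assert (h : length (l1 ++ v :: l2) <= length (v :: l2)).
      { apply hmin; repeat split.
        - apply walk_app in hw; apply hw.
        - intros w hw'; apply hS, in_app_iff; auto.
        - exists v; split; auto; reflexivity.
        - exists y; split; auto; apply last_vertex_app in ly; auto. }
      rewrite length_app in h; destruct l1; simpl in h; [|lia].
      inversion fx; auto.
    + intros v hv Bv; apply in_split in hv; destruct hv as [l1 [l2 ->]].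
      assert (h : length (l1 ++ v :: l2) <= length (l1 ++ [v])).
      { apply hmin; repeat split.
        - apply walk_app in hw; apply hw.
        - intros w hw'; apply hS; rewrite in_app_iff in *; simpl in *; tauto.
        - exists x; split; auto; eapply first_vertex_app, fx.
        - exists v; split; auto; apply last_vertex_snoc. }
      rewrite !length_app in h; destruct l2; simpl in h; [|lia].
      eapply last_vertex_eq; [apply last_vertex_snoc|exact ly].
Qed.

Lemma disjoint_sequence (Phi : nat -> list V -> Prop) :
  (forall k X, exists p, Phi k p /\ forall v, In v p -> ~ In v X) ->
  exists P, (forall k, Phi k (P k)) /\ forall m n, m <> n -> disjoint_paths (P m) (P n).
Proof.
  intros h.
  destruct (history_choice (fun k L p => Phi k p /\ forall v, In v p -> ~ In v (concat L)))
    as [P [L hP]].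
  { intros n l; apply h. }
  exists P; split; [intros k; apply hP|].
  assert (lt : forall m n, m < n -> disjoint_paths (P m) (P n)).
  { intros m n hmn v h1 h2; destruct (hP n) as [[_ h3] h4].
    apply (h3 v h2), in_concat; eauto. }
  intros m n hmn v h1 h2; destruct (lt_eq_lt_dec m n) as [[k|k]|k].
  - exact (lt m n k v h1 h2).
  - contradiction.
  - exact (lt n m k v h2 h1).
Qed.

(** Finite inseparability inside [S]. By greedy choice it amounts to infinitely many disjoint paths
    ([linked_paths], [paths_linked]), but it is easier to compose. *)
Definition linked (S A B : V -> Prop) : Prop :=
  forall X : list V, exists a b, A a /\ B b /\ reach (fun v => S v /\ ~ In v X) a b.

Definition everywhere (v : V) : Prop := True.

Lemma linked_sym S A B : linked S A B -> linked S B A.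
Proof.
  intros h X; destruct (h X) as [a [b [ha [hb hr]]]].
  exists b, a; repeat split; auto; apply reach_sym, hr.
Qed.

Lemma linked_mono (S S' A A' B B' : V -> Prop) :
  (forall v, S v -> S' v) -> (forall v, A v -> A' v) -> (forall v, B v -> B' v) ->
  linked S A B -> linked S' A' B'.
Proof.
  intros h1 h2 h3 h X; destruct (h X) as [a [b [ha [hb hr]]]].
  exists a, b; repeat split; auto; eapply reach_mono; [|exact hr]; simpl; firstorder.
Qed.

Lemma linked_paths S A B : linked S A B ->
  exists P : nat -> list V, (forall n, AB_path adj A B (P n)) /\
    (forall n v, In v (P n) -> S v) /\
    (forall m n, m <> n -> disjoint_paths (P m) (P n)).
Proof.
  intros h.
  destruct (disjoint_sequence (fun _ p => AB_path adj A B p /\ forall v, In v p -> S v))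
    as [P [h1 h2]].
  - intros _ X; destruct (h X) as [a [b [ha [hb hr]]]].
    destruct (AB_path_of_reach _ _ _ _ _ ha hb hr) as [p [hp1 hp2]].
    exists p; split; [split; auto|]; intros v hv; apply hp2, hv.
  - exists P; split; [|split; auto]; intros n; apply h1.
Qed.

Lemma paths_linked (S A B : V -> Prop) (P : nat -> list V) :
  (forall n, walk adj (P n)) -> (forall n v, In v (P n) -> S v) ->
  (forall n, exists a, A a /\ In a (P n)) -> (forall n, exists b, B b /\ In b (P n)) ->
  (forall m n, m <> n -> disjoint_paths (P m) (P n)) -> linked S A B.
Proof.
  intros h1 h2 h3 h4 h5 X.
  destruct (eventually_avoid (fun n v => In v (P n))) with (X := X) as [N hN].
  { intros m n v hm hn; apply NNPP; intros ne; exact (h5 m n ne v hm hn). }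
  destruct (h3 N) as [a [ha ia]], (h4 N) as [b [hb ib]].
  exists a, b; repeat split; auto.
  apply (walk_reach _ (P N)); eauto.
Qed.

Lemma AB_path_walk A B p : AB_path adj A B p -> walk adj p.
Proof. intros [[_ [_ h]] _]; auto. Qed.

Lemma AB_path_first A B p : AB_path adj A B p -> exists x, first_vertex p x /\ A x.
Proof. intros [_ (x & y & h)]; exists x; tauto. Qed.

Lemma AB_path_last A B p : AB_path adj A B p -> exists y, last_vertex p y /\ B y.
Proof. intros [_ (x & y & h)]; exists y; tauto. Qed.

Lemma equiv_linked r s : equiv_rays adj r s <-> linked everywhere (on_ray r) (on_ray s).
Proof.
  split.
  - intros [P [h1 h2]]; apply (paths_linked _ _ _ P); auto.
    + intros n; eapply AB_path_walk, h1.
    + intros n v _; exact I.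
    + intros n; destruct (AB_path_first _ _ _ (h1 n)) as [x [hx hr]].
      exists x; split; auto; apply first_vertex_in, hx.
    + intros n; destruct (AB_path_last _ _ _ (h1 n)) as [x [hx hr]].
      exists x; split; auto; apply last_vertex_in, hx.
  - intros h; destruct (linked_paths _ _ _ h) as [P [h1 [_ h2]]]; exists P; auto.
Qed.

Lemma ray_reach (S : V -> Prop) r N :
  is_ray adj r -> (forall k, N <= k -> S (r k)) ->
  forall m n, N <= m -> N <= n -> reach S (r m) (r n).
Proof.
  intros hr hS.
  assert (h : forall m d, N <= m -> reach S (r m) (r (m + d))).
  { intros m d hm; induction d as [|d IH].
    - rewrite Nat.add_0_r; constructor; auto.
    - eapply reach_trans; [exact IH|].
      rewrite Nat.add_succ_r; eapply reach_step; [apply hS; lia|apply hr|constructor; apply hS; lia]. }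
  intros m n hm hn; destruct (le_lt_dec m n) as [k|k].
  - replace n with (m + (n - m)) by lia; apply h; auto.
  - apply reach_sym; replace m with (n + (m - n)) by lia; apply h; auto.
Qed.

Lemma ray_tail_avoids r (X : list V) :
  is_ray adj r -> exists N, forall n, N <= n -> ~ In (r n) X.
Proof.
  intros hr; destruct (eventually_avoid (fun n v => r n = v)) with (X := X) as [N hN].
  - intros m n v h1 h2; apply hr; congruence.
  - exists N; intros n hn; eapply hN; eauto.
Qed.

(** Besides [X], an initial piece of [r] is deleted, so that both connections reach [r] in a tail
    avoiding [X], and this tail joins them. *)
Lemma linked_trans A B r :
  is_ray adj r -> linked everywhere A (on_ray r) -> linked everywhere (on_ray r) B ->
  linked everywhere A B.
Proof.
  intros hr h1 h2 X.
  destruct (ray_tail_avoids r X hr) as [N hN].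
  set (Y := X ++ map r (seq 0 N)).
  assert (hY : forall n, ~ In (r n) Y -> N <= n).
  { intros n hn; apply Nat.nlt_ge; intros hl; apply hn, in_app_iff; right.
    apply in_map, in_seq; lia. }
  assert (hm : forall v, everywhere v /\ ~ In v Y -> everywhere v /\ ~ In v X).
  { intros v [_ h]; split; [exact I|]; intros hx; apply h, in_app_iff; auto. }
  destruct (h1 Y) as [a [? [ha [[m <-] r1]]]], (h2 Y) as [? [b [[n <-] [hb r2]]]].
  exists a, b; do 2 (split; auto).
  eapply reach_trans; [eapply reach_mono; [exact hm|exact r1]|].
  eapply reach_trans; [|eapply reach_mono; [exact hm|exact r2]].
  apply (ray_reach _ r N hr).
  - intros k hk; split; [exact I|auto].
  - apply hY; apply reach_sym, reach_start in r1; tauto.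
  - apply hY; apply reach_start in r2; tauto.
Qed.

(* If the points [W n] cannot be separated from each other by finite sets,
   a finite path ending in one of them extends to the next missing one, and so on. *)
Lemma ray_through (Z : V -> Prop) (W : nat -> V) :
  (forall n, Z (W n)) -> (forall X : list V, exists n, ~ In (W n) X) ->
  (forall X m n, ~ In (W m) X -> ~ In (W n) X -> reach (fun v => Z v /\ ~ In v X) (W m) (W n)) ->
  exists C, is_ray adj C /\ (forall n, Z (C n)) /\ forall n, on_ray C (W n).
Proof.
  intros hS hinf hr.
  pose (ok := fun l => NoDup l /\ walk adj l /\ (forall v, In v l -> Z v) /\
                       exists m l', l = l' ++ [W m]).
  assert (step : forall (k : nat) (l : {l | ok l}), exists l' : {l | ok l},
             (exists t, proj1_sig l' = proj1_sig l ++ t) /\ In (W k) (proj1_sig l')).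
  { intros k [l hl]; simpl; destruct (classic (In (W k) l)) as [i|ni].
    - exists (exist _ l hl); split; auto; exists []; rewrite app_nil_r; auto.
    - pose proof hl as [nd [hw [hs [m [l0 e]]]]].
      assert (nm : ~ In (W m) l0).
      { subst l; apply NoDup_remove_2 in nd; rewrite app_nil_r in nd; auto. }
      assert (nk : ~ In (W k) l0) by (subst l; rewrite in_app_iff in ni; tauto).
      (* Only [l0], the list without its last vertex [W m], is avoided, since the new piece starts
         at that vertex. *)
      destruct (AB_path_of_reach _ (fun v => v = W m) (fun v => v = W k) _ _
                  eq_refl eq_refl (hr l0 m k nm nk)) as [p [hp hpS]].
      destruct hp as [[_ [ndp wp]] [x [y [fx [ly [-> [-> _]]]]]]].
      destruct p as [|x p]; inversion fx; subst x.
      assert (ok' : ok (l0 ++ W m :: p)).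
      { split; [|split; [|split]].
        - apply NoDup_app; auto.
          + subst l; apply NoDup_app_remove_r in nd; auto.
          + intros v h1 h2; apply (hpS v h2), h1.
        - apply walk_app; split; auto; subst l; auto.
        - intros v hv; apply in_app_iff in hv; destruct hv as [hv|hv].
          + apply hs; subst l; apply in_app_iff; auto.
          + apply hpS, hv.
        - destruct (exists_last (l := W m :: p)) as [q [z e']]; [discriminate|].
          exists k, (l0 ++ q); rewrite <- app_assoc; f_equal; rewrite e' in *.
          f_equal; f_equal; eapply last_vertex_eq; [apply last_vertex_snoc|exact ly]. }
      exists (exist _ _ ok'); simpl; split.
      + exists p; subst l; rewrite <- app_assoc; reflexivity.
      + apply in_app_iff; right; apply last_vertex_in, ly. }
  destruct (choice_fun (fun (kl : nat * {l | ok l}) (l' : {l | ok l}) =>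
              (exists t, proj1_sig l' = proj1_sig (snd kl) ++ t) /\
              In (W (fst kl)) (proj1_sig l'))) as [nx hnx].
  { intros [k l]; apply (step k l). }
  assert (ok0 : ok [W 0]).
  { split; [|split; [|split]].
    - constructor; [intros []|constructor].
    - exact I.
    - intros v [<-|[]]; auto.
    - exists 0, []; auto. }
  pose (L := fix L n := match n with 0 => exist ok _ ok0 | S n => nx (n, L n) end).
  pose (l := fun n => proj1_sig (L n)).
  assert (pre : forall m n, m <= n -> exists t, l n = l m ++ t).
  { intros m n h; induction h as [|n h [t ht]].
    - exists []; rewrite app_nil_r; auto.
    - destruct (hnx (n, L n)) as [[t' ht'] _]; exists (t ++ t').
      rewrite app_assoc, <- ht; exact ht'. }
  assert (mem : forall n, In (W n) (l (S n))) by (intros n; apply (hnx (n, L n))).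
  (* By [hinf] some [W j] is missing from any given list, so the lists outgrow every length and
     their union is infinite. *)
  assert (long : forall k, exists n, k <= length (l n)).
  { induction k as [|k [n hn]]; [exists 0; lia|].
    destruct (hinf (l n)) as [j hj]; exists (max n (S j)).
    destruct (pre n (max n (S j))) as [t ht]; [lia|].
    destruct (pre (S j) (max n (S j))) as [t' ht']; [lia|].
    assert (hin : In (W j) (l n ++ t)).
    { rewrite <- ht, ht'; apply in_app_iff; auto. }
    rewrite ht, length_app; apply in_app_iff in hin; destruct hin as [hin|hin]; [contradiction|].
    destruct t; [destruct hin|simpl; lia]. }
  destruct (choice_fun (fun k n => S k <= length (l n))) as [N hN]; [intros k; apply long|].
  pose (C := fun k => nth k (l (N k)) (W 0)).
  assert (hC : forall k n, k < length (l n) -> C k = nth k (l n) (W 0)).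
  { intros k n h; unfold C; pose proof (hN k) as h'.
    destruct (le_lt_dec n (N k)) as [q|q].
    - destruct (pre _ _ q) as [t ->]; rewrite app_nth1; auto.
    - destruct (pre (N k) n) as [t ->]; [lia|]; rewrite app_nth1; auto. }
  assert (okl : forall n, ok (l n)) by (intros n; apply proj2_sig).
  exists C; split; [split|split].
  - intros m n e; set (k := max m n); pose proof (hN k) as hk.
    rewrite (hC m (N k)), (hC n (N k)) in e by lia.
    apply (proj1 (NoDup_nth _ (W 0)) (proj1 (okl (N k)))) in e; auto; lia.
  - intros n; pose proof (hN (S n)) as hk.
    rewrite (hC n (N (S n))), (hC (S n) (N (S n))) by lia.
    pose proof (proj1 (proj2 (okl (N (S n))))) as hw; revert hw hk.
    generalize (l (N (S n))); clear; revert n.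
    intros n p; revert n; induction p as [|a p IH]; intros n hw hk; simpl in hk; [lia|].
    destruct p as [|b p]; simpl in hk; [lia|].
    destruct n as [|n]; [exact (proj1 hw)|].
    apply (IH n); [exact (proj2 hw)|simpl; lia].
  - intros n; apply (proj1 (proj2 (proj2 (okl (N n))))), nth_In, hN.
  - intros n; destruct (In_nth _ _ (W 0) (mem n)) as [k [hk e]].
    exists k; rewrite (hC k (S n)); auto.
Qed.

(** The paths start in a set, not at one vertex. Indexing them by their last vertices makes [U]
    injective ([fan_inj]) and lets fans be thinned by index ([fan_sub]). *)
Definition fan (X : V -> Prop) (U : nat -> V) (P : nat -> list V) : Prop :=
  (forall n, AB_path adj X (fun v => exists n, U n = v) (P n)) /\
  (forall n, last_vertex (P n) (U n)) /\
  (forall m n, m <> n -> disjoint_paths (P m) (P n)).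

Section Fan.
Context {X : V -> Prop} {U : nat -> V} {P : nat -> list V} (hf : fan X U P).

Lemma fan_last_in n : In (U n) (P n).
Proof. apply last_vertex_in, hf. Qed.

Lemma fan_inj m n : U m = U n -> m = n.
Proof.
  intros e; apply NNPP; intros ne; apply (proj2 (proj2 hf) m n ne (U m)).
  - apply fan_last_in.
  - rewrite e; apply fan_last_in.
Qed.

Lemma fan_meets n m : In (U m) (P n) -> m = n.
Proof.
  intros h; apply NNPP; intros ne; exact (proj2 (proj2 hf) m n ne _ (fan_last_in m) h).
Qed.

Lemma fan_same m n v : In v (P m) -> In v (P n) -> m = n.
Proof. intros h1 h2; apply NNPP; intros ne; exact (proj2 (proj2 hf) m n ne v h1 h2). Qed.

Lemma fan_first n : exists x, first_vertex (P n) x /\ X x /\ forall v, In v (P n) -> X v -> v = x.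
Proof. destruct hf as [h _]; destruct (h n) as [_ (x & y & k)]; exists x; tauto. Qed.

Lemma fan_sub (phi : nat -> nat) :
  (forall m n, phi m = phi n -> m = n) ->
  fan X (fun n => U (phi n)) (fun n => P (phi n)).
Proof.
  intros inj; destruct hf as [h1 [h2 h3]]; split; [|split]; auto.
  intros n; destruct (h1 (phi n)) as [hp (x & y & a & b & c & d & e & f)].
  split; auto; exists x, (U (phi n)); repeat split; eauto.
  intros v hv [m <-]; f_equal; apply fan_meets in hv; congruence.
Qed.

Lemma fan_linked S : (forall n v, In v (P n) -> S v) -> linked S X (fun v => exists n, U n = v).
Proof.
  intros hS; apply (paths_linked _ _ _ P); [|exact hS| | |apply hf].
  - intros n; eapply AB_path_walk, hf.
  - intros n; destruct (fan_first n) as [x [h [h' _]]]; exists x; split; auto.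
    apply first_vertex_in, h.
  - intros n; exists (U n); split; eauto; apply fan_last_in.
Qed.

End Fan.

Lemma fan_reach S r U P m n :
  is_ray adj r -> fan (on_ray r) U P -> (forall k, S (r k)) ->
  (forall v, In v (P m) -> S v) -> (forall v, In v (P n) -> S v) ->
  reach S (U m) (U n).
Proof.
  intros hr hf h0 h1 h2.
  destruct (fan_first hf m) as [x [fx [[i <-] _]]], (fan_first hf n) as [y [fy [[j <-] _]]].
  apply (reach_trans _ _ (r i)); [|apply (reach_trans _ _ (r j))].
  - apply (walk_reach _ (P m)); auto; [eapply AB_path_walk, hf|apply (fan_last_in hf)|].
    apply first_vertex_in, fx.
  - apply (ray_reach _ r 0 hr); auto; lia.
  - apply (walk_reach _ (P n)); auto; [eapply AB_path_walk, hf| |apply (fan_last_in hf)].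
    apply first_vertex_in, fy.
Qed.

End Graph.

(** * Many fans onto one countable set *)

Lemma nat_seq_uncountable : ~ le_card (nat -> nat) nat.
Proof.
  intros h; apply (lt_card_power nat); eapply le_card_trans; [|exact h].
  exists (fun P n => if excluded_middle_informative (P n) then 1 else 0).
  intros P Q e; extensionality n; apply propositional_extensionality.
  pose proof (f_equal (fun w => w n) e) as h'; simpl in h'.
  destruct (excluded_middle_informative (P n)), (excluded_middle_informative (Q n)); tauto || discriminate.
Qed.

(** The least uncountable cardinal is small because it is at most $\omega^\omega$; a countable
    cofinal sequence would make it a countable union of countable segments. *)
Lemma omega1_exists {small : CType -> Prop} (si : small_ideal small) :
  exists (O : CType) (lt : O -> O -> Prop), strict_well_order lt /\ small O /\ inhabited O /\
    forall s : nat -> O, exists b, forall n, lt (s n) b.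
Proof.
  destruct (least_card (fun B => ~ le_card B nat) (nat -> nat) nat_seq_uncountable)
    as [O [unc min]].
  destruct (initial_order_exists O) as [lt ini]; exists O, lt.
  assert (inf : infinite_type O) by (destruct (le_card_total nat O); tauto).
  split; [apply ini|split; [|split]].
  - apply (small_le _ si _ (nat -> nat)); [|apply (small_seq _ si), (small_nat _ si)].
    apply min, nat_seq_uncountable.
  - destruct inf as [f _]; exact (inhabits (f 0)).
  - intros s; apply NNPP; intros no; apply unc.
    apply (le_card_trans _ {n : nat & {y | ~ lt (s n) y}}).
    + apply (le_card_surj (fun p : {n : nat & {y | ~ lt (s n) y}} => proj1_sig (projT2 p))).
      intros y; apply NNPP; intros ny; apply no; exists y; intros n; apply NNPP; intros hn.
      apply ny; exists (existT (fun n => {y | ~ lt (s n) y}) n (exist _ y hn)); auto.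
    + eapply le_card_trans; [apply (le_card_sigma _ _ nat)|apply le_card_nat_prod].
      intros n; apply NNPP; intros h; apply (initial_le_segment ini inf (s n)); auto.
Qed.

(** Greedy choice along a well-order: [x] enters exactly if it is a candidate compatible with all
    earlier members. *)
Lemma maximal_compatible {T : Type} (cand : T -> Prop) (compat : T -> T -> Prop) :
  (forall x y, compat x y -> compat y x) ->
  exists M : T -> Prop, (forall x, M x -> cand x) /\
    (forall x y, M x -> M y -> x <> y -> compat x y) /\
    (forall x, cand x -> (forall y, M y -> compat x y) -> M x).
Proof.
  intros sym; destruct (strict_well_order_exists T) as [lt wo].
  pose (F := fun x (g : forall y, lt y x -> Prop) =>
               cand x /\ forall y (h : lt y x), g y h -> compat x y).
  pose (M := Fix (swo_wf wo) (fun _ => Prop) F).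
  assert (hM : forall x, M x <-> cand x /\ forall y, lt y x -> M y -> compat x y).
  { intros x; unfold M at 1; rewrite Fix_eq; [reflexivity|].
    intros z g g' e; assert (g = g') as ->; auto.
    extensionality u; extensionality v; auto. }
  exists M; split; [|split].
  - intros x h; apply hM, h.
  - intros x y hx hy ne; destruct (swo_total wo x y) as [k|[k|k]]; [|contradiction|].
    + apply sym; apply (proj1 (hM y) hy); auto.
    + apply (proj1 (hM x) hx); auto.
  - intros x h1 h2; apply hM; auto.
Qed.

Definition body {V I : Type} (Z : I -> V -> Prop) (i : I) (P : nat -> list V) (v : V) : Prop :=
  Z i v \/ exists n, In v (P n).

(** [X i] is where the fan starts, [Z i] is what is reserved for it: the ray itself when rays send
    fans onto a hub, nothing when the fans start from hubs, which may overlap. *)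
Definition fan_system {V I : Type} (adj : V -> V -> Prop) (X Z : I -> V -> Prop)
    (U : nat -> V) (Lam : I -> Prop) (P : I -> nat -> list V) : Prop :=
  (forall i, Lam i -> fan (adj := adj) (X i) U (P i) /\ forall n, ~ Z i (U n)) /\
  (forall i j v, Lam i -> Lam j -> i <> j ->
     body Z i (P i) v -> body Z j (P j) v -> exists n, U n = v).

(* Otherwise the maximal fan systems [M U] are small for all [U]; closing [r0] off under
   [U |-> M U] in [omega_1] steps gives a small set [A] containing [M U] for every sequence [U]
   in [A]. Some [X i] is not used in [A], and the paths from [X i] to [A] form
   a fan onto a sequence in [A] that contradicts the maximality of its system. *)
Lemma many_fans {V : CType} {adj : V -> V -> Prop} (adj_sym : forall x y, adj x y -> adj y x)
    {small : CType -> Prop} (si : small_ideal small) (r0 : nat -> V)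
    (I : CType) (X Z : I -> V -> Prop) :
  (forall i, linked (adj := adj) everywhere (X i) (on_ray r0)) ->
  (forall i, exists e : nat -> V, forall v, Z i v -> exists n, e n = v) ->
  (forall A : V -> Prop, small {v | A v} -> small {i | exists v, A v /\ Z i v}) ->
  ~ small I ->
  exists U Lam P, ~ small {i | Lam i} /\ fan_system adj X Z U Lam P.
Proof.
  intros hX hZ hsZ hI; apply NNPP; intros no.
  assert (key : forall U, exists M : I * (nat -> list V) -> Prop,
    small {i | exists P, M (i, P)} /\
    (forall i P, M (i, P) -> forall i' P', M (i', P') -> i = i' -> P = P') /\
    (forall i P, fan (adj := adj) (X i) U P -> (forall n, ~ Z i (U n)) ->
       (forall j Q, M (j, Q) -> i <> j /\
          forall v, body Z i P v -> body Z j Q v -> exists n, U n = v) -> M (i, P))).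
  { intros U.
    (* Index and fan are chosen as a pair; compatibility demands different indices, so a system
       holds at most one fan per index. *)
    destruct (maximal_compatible
      (fun p : I * (nat -> list V) => fan (adj := adj) (X (fst p)) U (snd p) /\ forall n, ~ Z (fst p) (U n))
      (fun p q => fst p <> fst q /\
         forall v, body Z (fst p) (snd p) v -> body Z (fst q) (snd q) v -> exists n, U n = v))
      as [M [h1 [h2 h3]]].
    { intros x y [a b]; split; [auto|intros v c d; eauto]. }
    exists M.
    assert (fn : forall i P, M (i, P) -> forall i' P', M (i', P') -> i = i' -> P = P').
    { intros i P hi i' P' hi' e; apply NNPP; intros ne.
      apply (h2 _ _ hi hi'); simpl; auto; congruence. }
    split; [|split; auto].
    (* A system that is not small would be the wanted one. *)
    - apply NNPP; intros ns; apply no.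
      destruct (choice_fun (fun i P => (exists P, M (i, P)) -> M (i, P))) as [P hP].
      { intros i; destruct (classic (exists P, M (i, P))) as [[P hP]|n].
        - exists P; auto.
        - exists (fun _ => []); tauto. }
      exists U, (fun i => exists P, M (i, P)), P; split; auto; split.
      + intros i hi; exact (h1 _ (hP i hi)).
      + intros i j v hi hj ne; apply (h2 _ _ (hP i hi) (hP j hj)); congruence.
    - intros i P hf hz hc; apply h3; simpl; auto.
      intros [j Q] hM; apply hc, hM. }
  destruct (choice_fun _ key) as [M hM]; clear key.
  assert (hZ' : exists e : I -> nat -> V, forall i v, Z i v -> exists n, e i n = v)
    by (apply (choice_fun (fun i (e : nat -> V) => forall v, Z i v -> exists n, e n = v)); auto).
  destruct hZ' as [e he].
  pose (B := fun U v => exists i P, M U (i, P) /\ body Z i P v).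
  assert (sB : forall U, small {v | B U v}).
  { intros U; destruct (hM U) as [hs [hfn _]].
    destruct (choice_fun (fun (i : {i | exists P, M U (i, P)}) P => M U (proj1_sig i, P)))
      as [P hP]; [intros [i hi]; exact hi|].
    (* Enumerates all bodies of the system: tag [0] runs through [Z i], any other tag through the
       vertices of the paths. *)
    pose (g := fun q : {i | exists P, M U (i, P)} * (nat * (nat * nat)) =>
      match q with
      | (i, (0, (n, _))) => e (proj1_sig i) n
      | (i, (S _, (n, k))) => nth k (P i n) (r0 0)
      end).
    apply (small_image si g).
    - apply (small_prod si); auto; repeat apply (small_prod si); apply (small_nat _ si).
    - intros v [i [Q [hQ [hz|[n hn]]]]];
        pose (i' := exist (fun i => exists P, M U (i, P)) i (ex_intro _ Q hQ)).
      + destruct (he i v hz) as [n hn]; exists (i', (0, (n, 0))); exact hn.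
      + assert (hq : Q = P i') by (apply (hfn _ _ hQ _ _ (hP i')); reflexivity).
        rewrite hq in hn; destruct (In_nth _ _ (r0 0) hn) as [k [_ hk]].
        exists (i', (1, (n, k))); exact hk. }
  destruct (omega1_exists si) as [O [lt [wo [sO [[o0] bO]]]]].
  (* Stage [b] treats only sequences contained in one earlier stage. This suffices, since every
     sequence in the union of the stages is contained in one of them. *)
  pose (A := fix A b (acc : Acc lt b) {struct acc} : V -> Prop := fun v => on_ray r0 v \/
     exists c (h : lt c b) U, (forall n, A c (Acc_inv acc h) (U n)) /\ B U v).
  pose (Aset := fun b => A b (swo_wf wo b)).
  assert (hA : forall b v, Aset b v <-> on_ray r0 v \/
     exists c U, lt c b /\ (forall n, Aset c (U n)) /\ B U v).
  { assert (irr : forall b (a1 a2 : Acc lt b), A b a1 = A b a2).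
    { intros b a1 a2; f_equal; apply proof_irrelevance. }
    intros b v; unfold Aset at 1; destruct (swo_wf wo b) as [acc]; simpl; split;
      (intros [h|h]; [left; exact h|right]).
    - destruct h as [c [h [U [h1 h2]]]]; exists c, U; split; [exact h|split; auto].
      intros n; unfold Aset; rewrite (irr _ _ (acc c h)); apply h1.
    - destruct h as [c [U [h [h1 h2]]]]; exists c, h, U; split; auto.
      intros n; rewrite (irr _ _ (swo_wf wo c)); apply h1. }
  clearbody Aset; clear A.
  assert (mono : forall b c v, lt c b -> Aset c v -> Aset b v).
  { intros b c v h hc; apply hA; apply hA in hc; destruct hc as [hc|[d [U [h1 [h2 h3]]]]]; auto.
    right; exists d, U; split; auto; eapply (swo_trans wo); eauto. }
  assert (sA : forall b, small {v | Aset b v}).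
  { intros b; induction b as [b IH] using (well_founded_induction (swo_wf wo)).
    apply (small_sub si _ (fun v => on_ray r0 v \/
      exists p : {c : seg lt b & nat -> {u | Aset (proj1_sig c) u}}, B (fun n => proj1_sig (projT2 p n)) v)).
    - intros v hv; apply hA in hv; destruct hv as [hv|[c [U [h1 [h2 h3]]]]]; auto.
      right; exists (existT (fun c : seg lt b => nat -> {u | Aset (proj1_sig c) u})
        (exist _ c h1) (fun n => exist _ (U n) (h2 n))); exact h3.
    - apply (small_or si).
      + apply (small_countable si r0); auto.
      + apply (small_union si); auto; apply (small_sigma _ si).
        * apply (small_le _ si _ O); auto; apply le_card_sig.
        * intros [c hc]; apply (small_seq _ si), IH, hc. }
  pose (AA := fun v => exists b, Aset b v).
  assert (sAA : small {v | AA v}) by (apply (small_union si); auto).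
  (* The closure touches only small many indices; any other index [i] will contradict maximality. *)
  pose (used := fun i => (exists v, AA v /\ Z i v) \/
    exists p : {c : O & nat -> {u | Aset c u}}, exists P, M (fun n => proj1_sig (projT2 p n)) (i, P)).
  assert (su : small {i | used i}).
  { apply (small_or si); auto; apply (small_union si).
    - apply (small_sigma _ si); auto; intros c; apply (small_seq _ si), sA.
    - intros p; apply hM. }
  assert (hi : exists i, ~ used i).
  { apply NNPP; intros n; apply hI; apply (small_le _ si _ {i | used i}); auto.
    assert (h : forall i, used i) by (intros i; apply NNPP; eauto).
    exists (fun i => exist _ i (h i)); intros x y q; inversion q; auto. }
  destruct hi as [i hi].
  assert (hl : linked (adj := adj) everywhere (X i) AA).
  { eapply linked_mono; [| | |apply (hX i)]; auto.
    intros v hv; exists o0; apply hA; auto. }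
  destruct (linked_paths _ _ _ hl) as [P [hP [_ hdis]]].
  destruct (choice_fun (fun n y => last_vertex (P n) y /\ AA y)) as [U hU].
  { intros n; exact (AB_path_last _ _ _ (hP n)). }
  destruct (choice_fun (fun n b => Aset b (U n))) as [s hs]; [intros n; apply hU|].
  destruct (bO s) as [b hb].
  assert (hUb : forall n, Aset b (U n)) by (intros n; eapply mono; [apply hb|apply hs]).
  assert (onlast : forall n v, In v (P n) -> AA v -> v = U n).
  { intros n v hv ha; destruct (hP n) as [_ (x & y & _ & ly & _ & _ & _ & h)].
    rewrite (last_vertex_eq _ _ _ (proj1 (hU n)) ly); auto. }
  assert (hfan : fan (adj := adj) (X i) U P).
  { split; [|split; auto; intros n; apply hU].
    intros n; destruct (hP n) as [hp (x & y & h1 & h2 & h3 & h4 & h5 & h6)].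
    split; auto; exists x, (U n); split; [exact h1|split; [apply hU|split; [exact h3|split; [eauto|split; [auto|]]]]].
    intros v hv [m <-]; apply onlast; auto; apply hU. }
  assert (nz : forall v, AA v -> ~ Z i v) by (intros v h1 h2; apply hi; left; eauto).
  pose (p := existT (fun c => nat -> {u | Aset c u}) b (fun n => exist _ (U n) (hUb n))).
  apply hi; right; exists p, P.
  apply (hM U); auto.
  - intros n; apply nz, hU.
  - intros j Q hQ; split.
    + intros <-; apply hi; right; exists p, Q; exact hQ.
    (* [b'] is a stage after [b], so it contains all bodies of [M U]; a path of the new fan meets
       the closure only in its last vertex. *)
    + intros v hv hv'; destruct (bO (fun _ => b)) as [b' hb'].
      assert (av : AA v).
      { exists b'; apply hA; right; exists b, U; split; [apply (hb' 0)|split; auto].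
        exists j, Q; auto. }
      destruct hv as [hz|[n hn]]; [destruct (nz v av hz)|].
      exists n; symmetry; apply onlast; auto.
Qed.

(** * Trees of rays *)

(** The conclusion of [HC] with an index type not tied to the degree. *)
Definition connected_rays {V : Type} (adj : V -> V -> Prop) (E : (nat -> V) -> Prop) (J : Type) : Prop :=
  exists R : J -> nat -> V, (forall j, E (R j)) /\ disjoint_ray_family R /\
    exists H : J -> J -> Prop, connected_graph H /\ ray_graph V adj J R H.

(** The degree bounds the disjoint family indexed by [J], so [J] and [K] are equinumerous and the
    family can be reindexed. *)
Lemma connected_rays_transfer {V : CType} (adj : V -> V -> Prop) E (J K : CType) :
  end_degree V E K -> connected_rays adj E J -> le_card K J -> connected_rays adj E K.
Proof.
  intros [_ deg] [R [hE [dis [H [[h1 [h2 h3]] [P [p1 [p2 p3]]]]]]]] hK.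
  destruct (cantor_bernstein K J hK (deg J R hE dis)) as [f [inj surj]].
  exists (fun k => R (f k)); split; [auto|split].
  { intros i j ne; apply dis; auto. }
  exists (fun k l => H (f k) (f l)); split; [split; [|split]|].
  - auto.
  - auto.
  - assert (h : forall a b, clos_refl_trans J H a b -> forall x y, f x = a -> f y = b ->
      clos_refl_trans K (fun k l => H (f k) (f l)) x y).
    { intros a b h; induction h as [a b h|a|a b c k1 IH1 k2 IH2]; intros x y e1 e2.
      - apply rt_step; congruence.
      - assert (x = y) as -> by (apply inj; congruence); apply rt_refl.
      - destruct (surj b) as [z hz]; eapply rt_trans; eauto. }
    intros x y; exact (h _ _ (h3 (f x) (f y)) x y eq_refl eq_refl).
  - assert (un : forall v, in_union_rays V J R v <-> in_union_rays V K (fun k => R (f k)) v).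
    { intros v; split; intros [j hj].
      - destruct (surj j) as [k <-]; exists k; auto.
      - exists (f j); auto. }
    exists P; split; [|split; auto].
    + intros p hp; destruct (p1 p hp) as [q [x [y [a [b [c d]]]]]].
      split; auto; exists x, y; repeat (split; auto); intros hv.
      * apply d; auto; apply un; auto.
      * apply un, d; auto.
    + intros i j hij; destruct (p3 _ _ hij) as [Q [q1 q2]]; exists Q; split; auto.
Qed.

(** Connectedness goes through the root. Path bundles of different edges may meet on the rays: a
    vertex of a path that lies on a ray is an end of that path, so independence is not violated. *)
Lemma tree_ray_graph {V J : Type} (adj : V -> V -> Prop) (R : J -> nat -> V)
    (root : J) (par : J -> J) (Q : J -> nat -> list V) :
  disjoint_ray_family R ->
  (forall j, j <> root -> par j <> j) ->
  (forall j, exists n, Nat.iter n par j = root) ->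
  (forall j n, j <> root -> AB_path adj (on_ray (R j)) (on_ray (R (par j))) (Q j n)) ->
  (forall j m n, j <> root -> m <> n -> disjoint_paths (Q j m) (Q j n)) ->
  (forall j n k v, j <> root -> In v (Q j n) -> on_ray (R k) v -> k = j \/ k = par j) ->
  (forall i j m n v, i <> root -> j <> root -> i <> j -> In v (Q i m) -> In v (Q j n) ->
     in_union_rays V J R v) ->
  exists H, connected_graph H /\ ray_graph V adj J R H.
Proof.
  intros dis irr conn hQ hdis honly hind.
  set (H := fun i j => (i <> root /\ j = par i) \/ (j <> root /\ i = par j)).
  exists H; split; [split; [|split]|].
  - unfold H; tauto.
  - intros x [[h e]|[h e]]; apply (irr x h); auto.
  - assert (up : forall n j, Nat.iter n par j = root ->
      clos_refl_trans J H j root /\ clos_refl_trans J H root j).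
    { induction n as [|n IH]; intros j e.
      - simpl in e; subst; split; apply rt_refl.
      - rewrite Nat.iter_succ_r in e; destruct (IH _ e) as [a b].
        destruct (classic (j = root)) as [->|ne]; [split; apply rt_refl|]; split.
        + eapply rt_trans; [apply rt_step|exact a]; left; auto.
        + eapply rt_trans; [exact b|apply rt_step]; right; auto. }
    intros x y; destruct (conn x) as [m hm], (conn y) as [n hn].
    eapply rt_trans; eapply up; eauto.
  - assert (rp : forall j n, j <> root -> R_path V adj J R (Q j n)).
    { intros j n hj; destruct (hQ j n hj) as [hp (x & y & h1 & h2 & h3 & h4 & h5 & h6)].
      split; auto; exists x, y; split; [|split; [|split]]; auto.
      - intros ->; exact (dis (par j) j (irr j hj) y h4 h3).
      - intros v hv; split.
        + intros [k hk]; destruct (honly j n k v hj hv hk) as [->| ->]; auto.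
        + intros [->| ->]; [exists j|exists (par j)]; auto. }
    exists (fun p => exists j n, j <> root /\ p = Q j n); split; [|split].
    + intros p [j [n [hj ->]]]; auto.
    + intros p q [i [m [hi ->]]] [j [n [hj ->]]] ne v [h1 [h2 h3]] h4.
      destruct (classic (i = j)) as [->|nij].
      * apply (hdis j m n hj) with v; auto; congruence.
      * destruct (rp i m hi) as [_ [x [y [fx [ly [_ h]]]]]].
        destruct (proj1 (h v h1) (hind i j m n v hi hj nij h1 h4)) as [->| ->]; auto.
    + assert (half : forall j, j <> root -> exists Q' : nat -> list V,
        (forall n, (exists j n', j <> root /\ Q' n = Q j n') /\ joins V J R j (par j) (Q' n) /\
           joins V J R (par j) j (Q' n)) /\
        (forall m n, m <> n -> disjoint_paths (Q' m) (Q' n))).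
      { intros j hj; exists (Q j); split; [intros n; split; [eauto|]|auto].
        destruct (hQ j n hj) as [hp (x & y & h)]; split; exists x, y; tauto. }
      intros i j [[h ->]|[h ->]]; destruct (half _ h) as [Q' [h1 h2]];
        exists Q'; split; auto; intros n; split; apply h1.
Qed.

Section End.
Context {V : CType} {adj : V -> V -> Prop} (adj_sym : forall x y, adj x y -> adj y x).
Context {E : (nat -> V) -> Prop} {r0 : nat -> V} (ray0 : is_ray adj r0)
  (hE : forall r, E r <-> is_ray adj r /\ equiv_rays adj r r0).

Lemma end_ray r : E r -> is_ray adj r.
Proof. intros h; apply hE, h. Qed.

Lemma end_linked r : E r -> linked (adj := adj) everywhere (on_ray r) (on_ray r0).
Proof. intros h; apply (equiv_linked adj_sym), hE, h. Qed.

Lemma end_linked2 r s : E r -> E s -> linked (adj := adj) everywhere (on_ray r) (on_ray s).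
Proof.
  intros hr hs; apply (linked_trans adj_sym _ _ r0 ray0); [apply end_linked, hr|].
  apply (linked_sym adj_sym), end_linked, hs.
Qed.

Lemma end_of_linked C r :
  is_ray adj C -> E r -> linked (adj := adj) everywhere (on_ray C) (on_ray r) -> E C.
Proof.
  intros hC hr hl; apply hE; split; auto; apply (equiv_linked adj_sym).
  apply (linked_trans adj_sym _ _ r); auto; [apply end_ray, hr|apply end_linked, hr].
Qed.

Lemma end_of_fan C r U P :
  is_ray adj C -> E r -> fan (adj := adj) (on_ray r) U P -> (forall n, on_ray C (U n)) -> E C.
Proof.
  intros hC hr hf hU; apply (end_of_linked C r hC hr), (linked_sym adj_sym).
  eapply linked_mono; [| | |apply (fan_linked adj_sym hf everywhere)]; auto.
  - intros v [n <-]; auto.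
  - intros; exact I.
Qed.

(** [None] is the centre. It belongs to the end because it contains the last vertices of a fan from
    a member. *)
Lemma star_rays (C : nat -> V) (J : CType) (L U : J -> nat -> V) (P : J -> nat -> list V) :
  is_ray adj C -> inhabited J -> (forall j, E (L j)) ->
  (forall j, fan (adj := adj) (on_ray (L j)) (U j) (P j)) ->
  (forall j n, on_ray C (U j n)) -> (forall j n, ~ on_ray (L j) (U j n)) ->
  (forall j v, body (fun j => on_ray (L j)) j (P j) v -> on_ray C v -> exists n, U j n = v) ->
  (forall i j v, i <> j -> body (fun j => on_ray (L j)) i (P i) v ->
     body (fun j => on_ray (L j)) j (P j) v -> on_ray C v) ->
  connected_rays adj E (option J).
Proof.
  intros hC [j0] hL hf hUC hLU hCU hd.
  pose (R := fun o => match o with None => C | Some j => L j end).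
  assert (LC : forall j v, on_ray (L j) v -> ~ on_ray C v).
  { intros j v h1 h2; destruct (hCU j v (or_introl h1) h2) as [n <-]; exact (hLU j n h1). }
  exists R; split; [|split].
  - intros [j|]; simpl; auto; apply (end_of_fan C (L j0) (U j0) (P j0)); auto.
  - intros [i|] [j|] ne v h1 h2; simpl in *.
    + apply (LC i v h1), (hd i j); [congruence|left; auto|left; auto].
    + exact (LC i v h1 h2).
    + exact (LC j v h2 h1).
    + congruence.
  - apply (tree_ray_graph adj R None (fun _ => None)
      (fun o => match o with None => fun _ => [] | Some j => P j end)).
    + intros [i|] [j|] ne v h1 h2; simpl in *.
      * apply (LC i v h1), (hd i j); [congruence|left; auto|left; auto].
      * exact (LC i v h1 h2).
      * exact (LC j v h2 h1).
      * congruence.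
    + intros j hj e; congruence.
    + intros [j|]; [exists 1|exists 0]; reflexivity.
    + intros [j|] n hj; [|congruence]; simpl.
      destruct (proj1 (hf j) n) as [hp (x & y & h1 & h2 & h3 & h4 & h5 & h6)].
      split; auto; exists x, y; split; [|split; [|split; [|split; [|split]]]]; auto.
      * destruct h4 as [k <-]; auto.
      * intros v hv hvC; apply h6; auto; apply (hCU j); auto; right; eauto.
    + intros [j|] m n hj ne; [|congruence]; apply (hf j), ne.
    + intros [j|] n [k|] v hj hv hk; [|auto|congruence|congruence].
      left; f_equal; apply NNPP; intros ne; simpl in *.
      apply (LC k v hk), (hd k j v ne); [left; auto|right; eauto].
    + intros [i|] [j|] m n v hi hj ne h1 h2; [|congruence|congruence|congruence].
      exists None; apply (hd i j); [congruence|right; eauto|right; eauto].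
Qed.

End End.

(** Outside [U] the bodies are pairwise disjoint, so each vertex of [W] spoils at most one of
    them. *)
Lemma fan_system_avoid {V I : CType} {adj : V -> V -> Prop} {small : CType -> Prop}
    (si : small_ideal small) (X Z : I -> V -> Prop) U Lam P (W : V -> Prop) :
  fan_system adj X Z U Lam P -> ~ small {i | Lam i} -> small {v | W v} ->
  ~ small {i | Lam i /\ forall v, body Z i (P i) v -> W v -> exists n, U n = v}.
Proof.
  intros [_ hd] hL hW hs.
  pose (bad := fun i => Lam i /\ exists v, W v /\ body Z i (P i) v /\ ~ exists n, U n = v).
  apply (not_small_diff si Lam bad hL).
  - destruct (choice_fun (fun (i : {i | bad i}) (v : {v | W v}) =>
       body Z (proj1_sig i) (P (proj1_sig i)) (proj1_sig v) /\ ~ exists n, U n = proj1_sig v))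
      as [f hf].
    { intros [i [hi [v [h1 h2]]]]; exists (exist _ v h1); exact h2. }
    apply (small_le _ si _ {v | W v}); auto; exists f; intros x y e; apply sig_inj.
    apply NNPP; intros ne; destruct (hf x) as [h1 h2], (hf y) as [h3 h4].
    rewrite <- e in h3.
    apply h2, (hd (proj1_sig x) (proj1_sig y)); auto; [apply (proj2_sig x)|apply (proj2_sig y)].
  - eapply (small_sub si); [|exact hs]; intros i [h1 h2]; split; auto.
    intros v hv hw; apply NNPP; intros n; apply h2; split; eauto.
Qed.

(** * Hubs of rays and the rays through them *)

Section Hubs.
Context {V : CType} {adj : V -> V -> Prop} (adj_sym : forall x y, adj x y -> adj y x).
Context {E : (nat -> V) -> Prop} {r0 : nat -> V} (ray0 : is_ray adj r0)
  (hE : forall r, E r <-> is_ray adj r /\ equiv_rays adj r r0).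
Context {K : CType} {R : K -> nat -> V} (hR : forall i, E (R i)) (dis : disjoint_ray_family R).

Definition hub (U : nat -> V) (Lam : K -> Prop) (P : K -> nat -> list V) : Prop :=
  fan_system adj (fun i => on_ray (R i)) (fun i => on_ray (R i)) U Lam P.

Lemma hub_exists {small : CType -> Prop} (si : small_ideal small) :
  ~ small K -> exists U Lam P, ~ small {i | Lam i} /\ hub U Lam P.
Proof.
  intros hK; apply (many_fans adj_sym si r0); auto.
  - intros i; apply (end_linked adj_sym hE), hR.
  - intros i; exists (R i); auto.
  - intros A hA.
    destruct (choice_fun (fun (i : {i | exists v, A v /\ on_ray (R i) v}) (v : {v | A v}) =>
       on_ray (R (proj1_sig i)) (proj1_sig v))) as [f hf].
    { intros [i [v [h1 h2]]]; exists (exist _ v h1); exact h2. }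
    apply (small_le _ si _ {v | A v}); auto; exists f; intros x y e; apply sig_inj.
    apply NNPP; intros ne; apply (dis _ _ ne _ (hf x)); rewrite e; apply hf.
Qed.

(** The finite set [Y] spoils few bodies outside [U], and a fan path meets [U] only in its last
    vertex, so an unspoiled fan leads from [U m] to its ray. [hubs_reach] then joins two such rays
    within the end. *)
Lemma hub_reach_ray {small : CType -> Prop} (si : small_ideal small) U Lam P (Y : list V) m :
  hub U Lam P -> ~ small {i | Lam i} -> ~ In (U m) Y ->
  exists i, forall k, reach (adj := adj) (fun v => everywhere v /\ ~ In v Y) (U m) (R i k).
Proof.
  intros hh hL hm.
  destruct (not_small_inhabited si _ (fan_system_avoid si _ _ U Lam P (fun v => In v Y) hh hL
              (small_list si Y))) as [i [hi hav]].
  destruct (proj1 hh i hi) as [hf hU]; exists i; intros k.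
  destruct (fan_first hf m) as [x [fx [[j <-] _]]].
  apply (reach_trans _ _ (R i j)).
  - apply (walk_reach adj_sym _ (P i m)); [eapply AB_path_walk, hf| |apply (fan_last_in hf)|].
    + intros v hv; split; [exact I|]; intros hk.
      destruct (hav v) as [l <-]; auto; [right; eauto|].
      apply (fan_meets hf) in hv; congruence.
    + apply first_vertex_in, fx.
  - apply (ray_reach adj_sym _ (R i) 0); [eapply end_ray; eauto| |lia|lia].
    intros l _; split; [exact I|]; intros hl.
    destruct (hav (R i l)) as [q e]; auto; [left; exists l; auto|].
    apply (hU q); exists l; auto.
Qed.

Lemma hubs_reach {small small' : CType -> Prop} (si : small_ideal small) (si' : small_ideal small')
    U Lam P U' Lam' P' (Y : list V) m n :
  hub U Lam P -> ~ small {i | Lam i} -> hub U' Lam' P' -> ~ small' {i | Lam' i} ->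
  ~ In (U m) Y -> ~ In (U' n) Y ->
  reach (adj := adj) (fun v => everywhere v /\ ~ In v Y) (U m) (U' n).
Proof.
  intros h1 h2 h3 h4 hm hn.
  destruct (hub_reach_ray si U Lam P Y m h1 h2 hm) as [i hi].
  destruct (hub_reach_ray si' U' Lam' P' Y n h3 h4 hn) as [j hj].
  destruct (end_linked2 adj_sym ray0 hE _ _ (hR i) (hR j) Y) as [a [b [[k <-] [[l <-] hr]]]].
  apply (reach_trans _ _ (R i k)); auto; apply (reach_trans _ _ (R j l)); auto.
  apply (reach_sym adj_sym); auto.
Qed.

Lemma hub_inj {small : CType -> Prop} (si : small_ideal small) U Lam P :
  hub U Lam P -> ~ small {i | Lam i} -> forall m n, U m = U n -> m = n.
Proof.
  intros hh hL; destruct (not_small_inhabited si _ hL) as [i hi].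
  apply (fan_inj (proj1 (proj1 hh i hi))).
Qed.

Lemma connected_rays_not_small {small : CType -> Prop} (si : small_ideal small) :
  ~ small K -> exists J : CType, ~ small J /\ connected_rays adj E (option J).
Proof.
  intros hK; destruct (hub_exists si hK) as [U [Lam [P [hL hh]]]].
  destruct (ray_through (adj := adj) everywhere U) as [C [hC [_ hCU]]].
  - intros n; exact I.
  - apply injective_escapes, (hub_inj si U Lam P hh hL).
  - intros Y m n h1 h2; exact (hubs_reach si si U Lam P U Lam P Y m n hh hL hh hL h1 h2).
  - pose proof (fan_system_avoid si _ _ U Lam P (on_ray C) hh hL
      (small_countable si C _ (fun v h => h))) as hL'.
    exists {i | Lam i /\ forall v, body (fun i => on_ray (R i)) i (P i) v -> on_ray C v -> exists n, U n = v}.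
    split; auto.
    apply (star_rays adj_sym hE C _ (fun j => R (proj1_sig j)) (fun _ => U) (fun j => P (proj1_sig j))); auto.
    + destruct (not_small_inhabited si _ hL') as [i hi]; exact (inhabits (exist _ i hi)).
    + intros [i [h1 h2]]; apply (proj1 hh i h1).
    + intros [i [h1 h2]]; apply (proj1 hh i h1).
    + intros [i [h1 h2]] v hv hvC; apply (h2 v hv hvC).
    + intros [i [h1 h2]] [j [h3 h4]] v ne hi hj; simpl in *.
      destruct (proj2 hh i j v h1 h3) as [n <-]; auto.
      intros ->; apply ne, sig_inj; auto.
Qed.

End Hubs.

(** * Singular end degrees *)

Section Leaves.
Context {V : CType} {adj : V -> V -> Prop}.
Context {E : (nat -> V) -> Prop} {K : CType} {R : K -> nat -> V} (hR : forall i, E (R i)).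
Context {C : CType} {ltC : C -> C -> Prop} (wo : strict_well_order ltC) (D : C -> CType).
Context {small : C -> CType -> Prop} (si : forall c, small_ideal (small c)).
Context (U : C -> nat -> V) (Lam : C -> K -> Prop) (P : C -> K -> nat -> list V).
Context (hhub : forall c, hub (adj := adj) (R := R) (U c) (Lam c) (P c))
  (hLam : forall c, ~ small c {i | Lam c i})
  (earlier : forall c, small c {j : {c : C & D c} | ~ ltC c (projT1 j)}).

(* The fans are chosen greedily: those chosen before stage [c] cover only a [small c] set. *)
Lemma disjoint_leaves (W : V -> Prop) :
  (forall c, small c {v | W v}) -> (forall c n, W (U c n)) ->
  exists (L : {c : C & D c} -> nat -> V) (Q : {c : C & D c} -> nat -> list V),
    (forall j, E (L j)) /\
    (forall j, fan (adj := adj) (on_ray (L j)) (U (projT1 j)) (Q j)) /\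
    (forall j v, on_ray (L j) v -> ~ W v) /\
    (forall j n v, In v (Q j n) -> W v -> v = U (projT1 j) n) /\
    (forall i j v, i <> j -> body (fun j => on_ray (L j)) i (Q i) v ->
       body (fun j => on_ray (L j)) j (Q j) v -> W v).
Proof.
  intros sW WU; set (J := {c : C & D c}).
  destruct (strict_well_order_exists J) as [lt1 wo1].
  (* Stages come first in this order: whatever is chosen before [j] has stage at most that of [j],
     so [earlier] makes it small in the sense of that stage. *)
  pose proof (swo_lex wo (@projT1 C D) lt1 wo1) as woJ.
  set (lt := fun x y : J => ltC (projT1 x) (projT1 y) \/ projT1 x = projT1 y /\ lt1 x y) in woJ.
  pose (bd := fun (j : J) i v => body (fun i => on_ray (R i)) i (P (projT1 j) i) v).
  assert (sb : forall c j i, small c {v | bd j i v}).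
  { intros c j i; apply (small_or (si c)).
    - apply (small_countable (si c) (R i)); auto.
    - apply (small_union (si c)); [apply (small_nat _ (si c))|].
      intros n; apply (small_list (si c)). }
  assert (ex : forall j (g : forall j', lt j' j -> K), exists i, Lam (projT1 j) i /\
     forall v, bd j i v -> (W v \/ exists j' h, bd j' (g j' h) v) -> exists n, U (projT1 j) n = v).
  { intros j g; set (c := projT1 j).
    apply (not_small_inhabited (si c)).
    apply (fan_system_avoid (si c) _ _ _ _ _ _ (hhub c) (hLam c)).
    apply (small_or (si c)); auto.
    apply (small_sub (si c) _ (fun v => exists p : {j' | lt j' j}, bd (proj1_sig p) (g _ (proj2_sig p)) v)).
    - intros v [j' [h hv]]; exists (exist _ j' h); exact hv.
    - apply (small_union (si c)); auto.
      eapply (small_le _ (si c)); [|apply (earlier c)].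
      apply le_card_sub; intros j' [h|[h _]].
      + apply (swo_asym wo); exact h.
      + rewrite h; apply (swo_irrefl wo). }
  pose (F := fun j (g : forall j', lt j' j -> K) =>
         proj1_sig (constructive_indefinite_description _ (ex j g))).
  pose (phi := Fix (swo_wf woJ) (fun _ => K) F).
  assert (hphi : forall j, Lam (projT1 j) (phi j) /\
     forall v, bd j (phi j) v -> (W v \/ exists j', lt j' j /\ bd j' (phi j') v) ->
       exists n, U (projT1 j) n = v).
  { intros j; assert (e : phi j = F j (fun j' _ => phi j')).
    { unfold phi at 1; rewrite Fix_eq; [reflexivity|].
      intros z g g' e; assert (g = g') as ->; auto.
      extensionality u; extensionality v; auto. }
    rewrite e.
    destruct (proj2_sig (constructive_indefinite_description _ (ex j (fun j' _ => phi j')))) as [h1 h2].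
    split; [exact h1|]; intros v hv hw; apply (h2 v hv).
    destruct hw as [hw|[j' [h hw]]]; eauto. }
  clearbody phi.
  assert (hf : forall j, fan (adj := adj) (on_ray (R (phi j))) (U (projT1 j)) (P (projT1 j) (phi j)) /\
                         forall n, ~ on_ray (R (phi j)) (U (projT1 j) n)).
  { intros j; apply (proj1 (hhub (projT1 j))), hphi. }
  exists (fun j => R (phi j)), (fun j => P (projT1 j) (phi j)).
  split; [auto|split; [|split; [|split]]].
  - intros j; apply hf.
  - intros j v hv hw; destruct (proj2 (hphi j) v (or_introl hv) (or_introl hw)) as [n <-].
    exact (proj2 (hf j) n hv).
  - intros j n v hv hw.
    destruct (proj2 (hphi j) v (or_intror (ex_intro _ n hv)) (or_introl hw)) as [m <-].
    f_equal; exact (fan_meets (proj1 (hf j)) n m hv).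
  - assert (h : forall i j v, lt i j -> bd i (phi i) v -> bd j (phi j) v -> W v).
    { intros i j v hl h1 h2; destruct (proj2 (hphi j) v h2) as [n <-]; auto.
      right; exists i; auto. }
    intros i j v ne h1 h2; destruct (swo_total woJ i j) as [k|[k|k]]; [|contradiction|].
    + exact (h i j v k h1 h2).
    + exact (h j i v k h2 h1).
Qed.

End Leaves.

Lemma injective_subsequence (Q : nat -> Prop) :
  (forall N, exists n, N <= n /\ Q n) ->
  exists s : nat -> nat, (forall m n, s m = s n -> m = n) /\ forall n, Q (s n).
Proof.
  intros h; destruct (choice_fun _ h) as [g hg].
  pose (s := fix s n := match n with 0 => g 0 | S n => g (S (s n)) end).
  assert (inc : forall m n, m < n -> s m < s n).
  { intros m n hl; induction hl as [|n hl IH].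
    - apply (hg (S (s m))).
    - etransitivity; [exact IH|apply (hg (S (s n)))]. }
  exists s; split.
  - intros m n e; destruct (lt_eq_lt_dec m n) as [[k|k]|k]; auto; apply inc in k; lia.
  - intros [|n]; apply hg.
Qed.

Section Singular.
Context {V : CType} {adj : V -> V -> Prop} (adj_sym : forall x y, adj x y -> adj y x).
Context {E : (nat -> V) -> Prop} {r0 : nat -> V} (ray0 : is_ray adj r0)
  (hE : forall r, E r <-> is_ray adj r /\ equiv_rays adj r r0).
Context {K : CType} {R : K -> nat -> V} (hR : forall i, E (R i)).
Context {C : CType} {ltC : C -> C -> Prop} (ini : initial_order ltC).
(** Elements of [K] label the leaves of a stage. Each label is present from some stage on, so any
    unbounded set of stages still yields [K] many leaves. The factor [nat] in the leaf index
    provides spare leaves. *)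
Context (D : C -> K -> Prop) (D_inh : forall c, exists x, D c x)
  (D_cov : forall x, exists c0, forall c, ~ ltC c c0 -> D c x).
Context {small : C -> CType -> Prop} (si : forall c, small_ideal (small c))
  (smallC : forall c, small c C).
Context (U : C -> nat -> V) (Lam : C -> K -> Prop) (P : C -> K -> nat -> list V).
Context (hhub : forall c, hub (adj := adj) (R := R) (U c) (Lam c) (P c))
  (hLam : forall c, ~ small c {i | Lam c i})
  (earlier : forall c, small c {j : {c : C & ({x | D c x} * nat)%type} | ~ ltC c (projT1 j)}).

Lemma singular_countable (e : nat -> C) :
  (forall c, exists n, e n = c) -> exists J : CType, le_card K J /\ connected_rays adj E J.
Proof.
  intros he.
  pose (Wn := fun k => U (e (fst (Cantor.of_nat k))) (snd (Cantor.of_nat k))).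
  destruct (ray_through (adj := adj) everywhere Wn) as [C0 [hC [_ hCW]]].
  { intros n; exact I. }
  (* [Wn] may repeat vertices because hubs may overlap, but the points of a single hub already leave
     [Y]. *)
  { intros Y; destruct (injective_escapes (U (e 0))) with (Y := Y) as [n hn].
    - exact (hub_inj (si (e 0)) _ _ _ (hhub (e 0)) (hLam (e 0))).
    - exists (Cantor.to_nat (0, n)); unfold Wn; rewrite Cantor.cancel_of_to; exact hn. }
  { intros Y m n h1 h2.
    exact (hubs_reach adj_sym ray0 hE hR (si _) (si _) _ _ _ _ _ _ Y _ _
             (hhub _) (hLam _) (hhub _) (hLam _) h1 h2). }
  assert (hCU : forall c n, on_ray C0 (U c n)).
  { intros c n; destruct (he c) as [m <-].
    pose proof (hCW (Cantor.to_nat (m, n))) as h; unfold Wn in h.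
    rewrite Cantor.cancel_of_to in h; exact h. }
  destruct (disjoint_leaves hR (proj1 ini) _ si U Lam P hhub hLam earlier (on_ray C0))
    as [L [Q [hL [hf [LW [QW BB]]]]]]; auto.
  { intros c; apply (small_countable (si c) C0); auto. }
  assert (jx : forall x, exists j : {c : C & ({x | D c x} * nat)%type}, proj1_sig (fst (projT2 j)) = x).
  { intros x; destruct (D_cov x) as [c hc].
    exists (existT _ c (exist _ x (hc c (swo_irrefl (proj1 ini) c)), 0)); auto. }
  exists (option {c : C & ({x | D c x} * nat)%type}); split.
  - eapply le_card_trans.
    + apply (le_card_surj (fun j : {c : C & ({x | D c x} * nat)%type} => proj1_sig (fst (projT2 j))) jx).
    + exists Some; intros x y q; inversion q; auto.
  - apply (star_rays adj_sym hE C0 _ L (fun j => U (projT1 j)) Q); auto.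
    + destruct (D_inh (e 0)) as [x hx]; exact (inhabits (existT _ (e 0) (exist _ x hx, 0))).
    + intros j n h; exact (LW j _ h (hCU _ n)).
    + intros j v [h|[n h]] hv; [destruct (LW j v h hv)|].
      exists n; symmetry; apply (QW j n v h hv).
Qed.

Section LinkedHubs.
(** [P0 c n] starts at the hub point with index [k c n]. For a leaf [j] of stage [c], the path
    [Q j (k c n)] thus ends where [P0 c n] starts. *)
Context {U0 : nat -> V} {P0 : C -> nat -> list V} {Lam1 : C -> Prop} {C0 : nat -> V} {k : C -> nat -> nat}.
Context (hC0 : is_ray adj C0) (hU0 : forall n, on_ray C0 (U0 n))
  (hf0 : forall c, Lam1 c -> fan (adj := adj) (fun v => exists n, U c n = v) U0 (P0 c))
  (hd0 : forall c d m n v, Lam1 c -> Lam1 d -> c <> d -> In v (P0 c m) -> In v (P0 d n) ->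
     exists l, U0 l = v)
  (hC0P : forall c n v, Lam1 c -> In v (P0 c n) -> on_ray C0 v -> exists m, U0 m = v)
  (hk : forall c n, Lam1 c -> first_vertex (P0 c n) (U c (k c n))).
Context {W : V -> Prop} (hWC : forall v, on_ray C0 v -> W v) (hWU : forall c n, W (U c n))
  (hWP : forall c n v, In v (P0 c n) -> W v).
Context {L : {c : C & ({x | D c x} * nat)%type} -> nat -> V}
  {Q : {c : C & ({x | D c x} * nat)%type} -> nat -> list V}
  (hL : forall j, E (L j))
  (hf : forall j, fan (adj := adj) (on_ray (L j)) (U (projT1 j)) (Q j))
  (LW : forall j v, on_ray (L j) v -> ~ W v)
  (QW : forall j n v, In v (Q j n) -> W v -> v = U (projT1 j) n)
  (BB : forall i j v, i <> j -> body (fun j => on_ray (L j)) i (Q i) v ->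
     body (fun j => on_ray (L j)) j (Q j) v -> W v).
Context {Lam2 : C -> Prop} (Lam21 : forall c, Lam2 c -> Lam1 c)
  (Lam2_cover : forall x, exists c, Lam2 c /\ D c x).

Lemma link_inj c m n : Lam1 c -> k c m = k c n -> m = n.
Proof.
  intros hc e; apply (fan_same (hf0 c hc) m n (U c (k c m))).
  - apply first_vertex_in, hk, hc.
  - rewrite e; apply first_vertex_in, hk, hc.
Qed.

(** The selected linking paths are trivial, so the hub points they start from lie on [C0], and leaf
    fans thinned to these points end on [C0] directly. *)
Lemma one_level (s : C -> nat -> nat) :
  inhabited K ->
  (forall c, Lam2 c -> (forall m n, s c m = s c n -> m = n) /\
     forall n, U c (k c (s c n)) = U0 (s c n)) ->
  exists J : CType, le_card K J /\ connected_rays adj E J.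
Proof.
  intros [x0] hs.
  pose (J := {j : {c : C & ({x | D c x} * nat)%type} | Lam2 (projT1 j)}).
  assert (jx : forall x, exists j : J, proj1_sig (fst (projT2 (proj1_sig j))) = x).
  { intros x; destruct (Lam2_cover x) as [c [hc hx]].
    exists (exist (fun j => Lam2 (projT1 j))
      (existT (fun c => ({x | D c x} * nat)%type) c (exist _ x hx, 0)) hc); auto. }
  exists (option J); split.
  - eapply le_card_trans; [exact (le_card_surj _ jx)|].
    exists Some; intros x y q; inversion q; auto.
  - assert (inC : forall (j : J) n, on_ray C0 (U (projT1 (proj1_sig j))
                   (k (projT1 (proj1_sig j)) (s (projT1 (proj1_sig j)) n)))).
    { intros [j hj] n; simpl; rewrite (proj2 (hs _ hj)); auto. }
    assert (bW : forall (j : J) v,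
      body (fun j : J => on_ray (L (proj1_sig j))) j
        (fun n => Q (proj1_sig j) (k (projT1 (proj1_sig j)) (s (projT1 (proj1_sig j)) n))) v -> W v ->
      exists n, U (projT1 (proj1_sig j)) (k (projT1 (proj1_sig j)) (s (projT1 (proj1_sig j)) n)) = v).
    { intros j v [h|[n h]] hv; [destruct (LW _ v h hv)|].
      exists n; symmetry; apply (QW _ _ _ h hv). }
    apply (star_rays adj_sym hE C0 J (fun j => L (proj1_sig j))
      (fun j n => U (projT1 (proj1_sig j)) (k (projT1 (proj1_sig j)) (s (projT1 (proj1_sig j)) n)))
      (fun j n => Q (proj1_sig j) (k (projT1 (proj1_sig j)) (s (projT1 (proj1_sig j)) n)))); auto.
    + destruct (jx x0) as [j _]; exact (inhabits j).
    + intros [j hj]; simpl.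
      apply (fan_sub (hf j) (fun n => k (projT1 j) (s (projT1 j) n))).
      intros m n e; apply link_inj in e; auto; apply hs in e; auto.
    + intros j n h; exact (LW _ _ h (hWU _ _)).
    + intros i j v ne h1 h2.
      assert (w : W v).
      { apply (BB (proj1_sig i) (proj1_sig j)).
        - intros e; apply ne, sig_inj, e.
        - destruct h1 as [h|[n h]]; [left|right]; eauto.
        - destruct h2 as [h|[n h]]; [left|right]; eauto. }
      destruct (bW i v h1 w) as [n <-]; apply inC.
Qed.

(** From [N c] on the linking paths are nontrivial. Their starting points therefore avoid [C0] and
    differ for different [c], so each hub can get a ray of its own, placed in the tree between its
    leaves and [C0]. *)
Lemma two_level (N : C -> nat) :
  inhabited K ->
  (forall c n, Lam2 c -> N c <= n -> U c (k c n) <> U0 n) ->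
  exists J : CType, le_card K J /\ connected_rays adj E J.
Proof.
  intros [x0] hN; set (G := fun c => ({x | D c x} * nat)%type) in *.
  pose (psi := fun c n => k c (N c + n)); pose (u := fun c n => U c (psi c n)).
  assert (uP : forall c n, Lam2 c -> In (u c n) (P0 c (N c + n))).
  { intros c n hc; apply first_vertex_in, hk, Lam21, hc. }
  (* A starting point on [C0] would lie in [U0], which the linking path meets only in its last
     vertex; the path would be trivial. *)
  assert (uC0 : forall c n, Lam2 c -> ~ on_ray C0 (u c n)).
  { intros c n hc h; destruct (hC0P c (N c + n) _ (Lam21 c hc) (uP c n hc) h) as [m e].
    assert (m = N c + n) by (apply (fan_meets (hf0 c (Lam21 c hc))); rewrite e; auto).
    apply (hN c (N c + n) hc); [lia|]; subst m; symmetry; exact e. }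
  assert (psi_inj : forall c, Lam2 c -> forall m n, psi c m = psi c n -> m = n).
  { intros c hc m n e; apply (link_inj c _ _ (Lam21 c hc)) in e; lia. }
  assert (u_ne : forall c d m n, Lam2 c -> Lam2 d -> u c m = u d n -> c = d).
  { intros c d m n hc hd e; apply NNPP; intros ne.
    destruct (hd0 c d (N c + m) (N d + n) (u c m)) as [l hl]; auto.
    - rewrite e; auto.
    - apply (uC0 c m hc); rewrite <- hl; auto. }
  assert (rf : forall j, Lam2 (projT1 j) ->
    fan (adj := adj) (on_ray (L j)) (u (projT1 j)) (fun n => Q j (psi (projT1 j) n))).
  { intros j hj; exact (fan_sub (hf j) (psi (projT1 j)) (psi_inj _ hj)). }
  (* The region for the ray of stage [c] uses only spare leaves, those with index [S kk]; index [0]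
     is kept for the leaves of the tree. *)
  pose (S := fun c v => (exists n, u c n = v) \/
    exists x kk, let j := existT G c (x, Datatypes.S kk) in
      on_ray (L j) v \/ exists n, In v (Q j (psi c n))).
  assert (toB : forall j n v, In v (Q j n) -> body (fun j => on_ray (L j)) j (Q j) v)
    by (intros; right; eauto).
  assert (SW : forall c v, S c v -> W v -> exists n, u c n = v).
  { intros c v [h|[x [kk [h|[n h]]]]] hv; auto.
    - destruct (LW _ v h hv).
    - exists n; symmetry; apply (QW _ _ _ h hv). }
  assert (CCex : forall c, exists CC, Lam2 c ->
    is_ray adj CC /\ (forall n, S c (CC n)) /\ forall n, on_ray CC (u c n)).
  { intros c; destruct (classic (Lam2 c)) as [hc|nc]; [|exists C0; tauto].
    destruct (ray_through (adj := adj) (S c) (u c)) as [CC hCC]; [| | |exists CC; auto].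
    - intros n; left; eauto.
    - apply injective_escapes; intros m n e; apply (psi_inj c hc).
      exact (hub_inj (si c) _ _ _ (hhub c) (hLam c) _ _ e).
    - intros Y m n hm hn; destruct (D_inh c) as [x hx].
      pose (j := fun kk => existT G c (exist _ x hx, Datatypes.S kk)).
      (* The bodies of the spare leaves with label [x] are disjoint outside [W], so one of them
         avoids [Y] there, and its fan connects the two points. *)
      destruct (eventually_avoid (fun kk v => body (fun j => on_ray (L j)) (j kk) (Q (j kk)) v /\ ~ W v))
        with (X := Y) as [M hM].
      { intros a b v [h1 h2] [h3 h4]; apply NNPP; intros ne; apply h2, (BB (j a) (j b)); auto.
        intros e; apply ne; apply (f_equal (fun j => snd (projT2 j))) in e; simpl in e; congruence. }
      specialize (hM M (le_n M)).
      apply (fan_reach adj_sym _ (L (j M)) (u c) (fun n => Q (j M) (psi c n))).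
      + eapply end_ray; eauto.
      + exact (rf (j M) hc).
      + intros i; assert (hi : on_ray (L (j M)) (L (j M) i)) by (exists i; auto); split.
        * right; exists (exist _ x hx), M; left; exact hi.
        * apply hM; split; [left; exact hi|apply (LW _ _ hi)].
      + intros v hv; split; [right; exists (exist _ x hx), M; right; eauto|].
        destruct (classic (W v)) as [w|w]; [|apply hM; split; eauto].
        pose proof (QW _ _ _ hv w) as e; simpl in e; rewrite e; exact hm.
      + intros v hv; split; [right; exists (exist _ x hx), M; right; eauto|].
        destruct (classic (W v)) as [w|w]; [|apply hM; split; eauto].
        pose proof (QW _ _ _ hv w) as e; simpl in e; rewrite e; exact hn. }
  destruct (choice_fun _ CCex) as [CC hCC]; clear CCex.
  assert (CS : forall c v, Lam2 c -> on_ray (CC c) v -> S c v).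
  { intros c v hc [n <-]; apply (hCC c hc). }
  pose (I2 := {c | Lam2 c}); pose (J2 := {j : {c : C & {x | D c x}} | Lam2 (projT1 j)}).
  pose (lf := fun j : J2 => existT G (projT1 (proj1_sig j)) (projT2 (proj1_sig j), 0)).
  assert (lf_inj : forall i j, lf i = lf j -> i = j).
  { intros [[c x] hc] [[d y] hd] e; unfold lf in e; simpl in e; apply sig_inj; simpl.
    pose (back := fun j : {c : C & G c} => existT (fun c => {x | D c x}) (projT1 j) (fst (projT2 j))).
    exact (f_equal back e). }
  assert (SB : forall c v (j : J2), S c v -> body (fun j => on_ray (L j)) (lf j) (Q (lf j)) v -> W v).
  { intros c v j [[n <-]|[x [kk h]]] hb; [apply hWU|].
    apply (BB (existT G c (x, Datatypes.S kk)) (lf j)); auto.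
    - intros e; apply (f_equal (fun j => snd (projT2 j))) in e; discriminate.
    - destruct h as [h|[n h]]; [left; auto|eauto]. }
  assert (SL : forall c v (j : J2), S c v -> ~ on_ray (L (lf j)) v).
  { intros c v j hs hl; apply (LW _ _ hl), (SB c v j hs); left; auto. }
  assert (SS : forall c d v, Lam2 c -> Lam2 d -> S c v -> S d v -> c = d).
  { intros c d v hc hd h1 h2; destruct (classic (W v)) as [w|w].
    - destruct (SW _ _ h1 w) as [m <-], (SW _ _ h2 w) as [n e]; symmetry; eapply u_ne; eauto.
    - destruct h1 as [[n <-]|[x [kk h1]]]; [destruct w; apply hWU|].
      destruct h2 as [[n <-]|[y [ll h2]]]; [destruct w; apply hWU|].
      apply NNPP; intros ne; apply w.
      apply (BB (existT G c (x, Datatypes.S kk)) (existT G d (y, Datatypes.S ll))).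
      + intros e; apply ne; exact (f_equal (@projT1 _ _) e).
      + destruct h1 as [h|[n h]]; [left; auto|eauto].
      + destruct h2 as [h|[n h]]; [left; auto|eauto]. }
  assert (SC0 : forall c v, Lam2 c -> S c v -> ~ on_ray C0 v).
  { intros c v hc h h'; destruct (SW c v h (hWC v h')) as [n <-]; exact (uC0 c n hc h'). }
  (* The path of a leaf can meet a middle ray only in [W], hence only in its own last vertex. *)
  assert (QS : forall (j : J2) n d v, Lam2 d -> In v (Q (lf j) (psi (projT1 (proj1_sig j)) n)) -> S d v ->
    d = projT1 (proj1_sig j) /\ v = u (projT1 (proj1_sig j)) n).
  { intros j n d v hd hv hs; assert (w : W v) by (apply (SB d v j hs); eauto).
    pose proof (QW _ _ _ hv w) as e; simpl in e; split; auto.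
    destruct (SW d v hs w) as [m hm]; apply (u_ne d _ m n); auto; [apply (proj2_sig j)|].
    rewrite hm; exact e. }
  pose (RR := fun o : option (I2 + J2) => match o with
    | None => C0 | Some (inl c) => CC (proj1_sig c) | Some (inr j) => L (lf j) end).
  assert (dis2 : forall a b v, on_ray (RR a) v -> on_ray (RR b) v -> a = b).
  { intros [[[c hc]|i]|] [[[d hd]|j]|] v h1 h2; simpl in *; auto.
    - do 2 f_equal; apply sig_inj; simpl; eapply SS; eauto.
    - destruct (SL c v j); auto.
    - destruct (SC0 c v); auto.
    - destruct (SL d v i); auto.
    - do 2 f_equal; apply lf_inj, NNPP; intros ne.
      apply (LW _ _ h1), (BB _ _ _ ne); left; auto.
    - destruct (LW _ _ h1); auto.
    - destruct (SC0 d v); auto.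
    - destruct (LW _ _ h2); auto. }
  assert (jx : forall x, exists j : J2, proj1_sig (projT2 (proj1_sig j)) = x).
  { intros x; destruct (Lam2_cover x) as [c [hc hx]].
    exists (exist (fun j => Lam2 (projT1 j))
      (existT (fun c => {x | D c x}) c (exist _ x hx)) hc); auto. }
  exists (option (I2 + J2)); split.
  { eapply le_card_trans; [exact (le_card_surj _ jx)|].
    exists (fun j => Some (inr j)); intros x y q; inversion q; auto. }
  assert (rfl : forall j : J2, fan (adj := adj) (on_ray (L (lf j))) (u (projT1 (proj1_sig j)))
                  (fun n => Q (lf j) (psi (projT1 (proj1_sig j)) n))).
  { intros j; apply (rf (lf j)); exact (proj2_sig j). }
  assert (ECC : forall c, Lam2 c -> E (CC c)).
  { intros c hc; destruct (D_inh c) as [x hx].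
    pose (j := exist (fun j => Lam2 (projT1 j)) (existT (fun c => {x | D c x}) c (exist _ x hx)) hc : J2).
    apply (end_of_fan adj_sym hE _ _ _ _ (proj1 (hCC c hc)) (hL (lf j)) (rfl j)); apply (hCC c hc). }
  exists RR; split; [|split].
  - intros [[[c hc]|j]|]; simpl; auto.
    (* [C0] inherits membership in the end from a middle ray, through the linking paths between
       them. *)
    destruct (jx x0) as [[[c x] hc] _]; simpl in hc.
    apply (end_of_linked adj_sym hE C0 (CC c)); auto.
    pose proof (hf0 c (Lam21 c hc)) as hf1.
    apply (paths_linked adj_sym _ _ _ (fun n => P0 c (N c + n))).
    + intros n; eapply AB_path_walk, hf1.
    + intros; exact I.
    + intros n; exists (U0 (N c + n)); split; auto; apply (fan_last_in hf1).
    + intros n; exists (u c n); split; auto; apply (hCC c hc).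
    + intros m n ne; apply hf1; lia.
  - intros a b ne v h1 h2; apply ne; eapply dis2; eauto.
  - apply (tree_ray_graph adj RR None
      (fun o => match o with
        | None => None
        | Some (inl c) => None
        | Some (inr j) => Some (inl (exist Lam2 (projT1 (proj1_sig j)) (proj2_sig j))) end)
      (fun o n => match o with
        | None => []
        | Some (inl c) => P0 (proj1_sig c) (N (proj1_sig c) + n)
        | Some (inr j) => Q (lf j) (psi (projT1 (proj1_sig j)) n) end)).
    + intros a b ne v h1 h2; apply ne; eapply dis2; eauto.
    + intros [[c|j]|] hj; congruence.
    + intros [[c|j]|]; [exists 1|exists 2|exists 0]; reflexivity.
    + intros [[[c hc]|j]|] n hj; [| |congruence]; simpl.
      * destruct (proj1 (hf0 c (Lam21 c hc)) (N c + n)) as [hp (x & y & h1 & h2 & h3 & h4 & h5 & h6)].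
        pose proof (first_vertex_eq _ _ _ h1 (hk c (N c + n) (Lam21 c hc))) as ex.
        split; auto; exists x, y; split; [auto|split; [auto|split; [|split; [|split]]]].
        -- rewrite ex; apply (hCC c hc).
        -- destruct h4 as [l <-]; auto.
        (* Vertices of linking paths lie in [W], where the ray of [c] has only hub points; [h5]
           leaves just the first vertex. *)
        -- intros v hv hr; apply h5; auto.
           destruct (SW c v (CS c v hc hr) (hWP _ _ _ hv)) as [l <-]; eexists; reflexivity.
        -- intros v hv hr; apply h6; auto; exact (hC0P c _ v (Lam21 c hc) hv hr).
      * pose proof (rfl j) as hr0.
        destruct (proj1 hr0 n) as [hp (x & y & h1 & h2 & h3 & h4 & h5 & h6)].
        pose proof (last_vertex_eq _ _ _ h2 (proj1 (proj2 hr0) n)) as ey.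
        split; auto; exists x, y; split; [auto|split; [auto|split; [auto|split; [|split; [auto|]]]]].
        -- rewrite ey; apply (hCC _ (proj2_sig j)).
        -- intros v hv hr; rewrite ey; apply (QS j n _ v (proj2_sig j) hv), CS; auto.
           exact (proj2_sig j).
    + intros [[[c hc]|j]|] m n hj ne; [| |congruence]; simpl.
      * apply (hf0 c (Lam21 c hc)); lia.
      * apply (rfl j), ne.
    + intros [[[c hc]|j]|] n [[[d hd]|i]|] v hj hv hr; simpl in *; auto; try congruence.
      * left; do 2 f_equal; apply sig_inj; simpl; apply NNPP; intros ne.
        destruct (SW d v (CS d v hd hr) (hWP _ _ _ hv)) as [l <-].
        destruct (hd0 c d _ _ (u d l) (Lam21 c hc) (Lam21 d hd) (fun e => ne (eq_sym e)) hv (uP d l hd))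
          as [q hq].
        apply (uC0 d l hd); rewrite <- hq; auto.
      * destruct (LW _ _ hr); eauto.
      * right; do 2 f_equal; apply sig_inj; simpl.
        apply (QS j n d v hd hv), CS; auto.
      * left; do 2 f_equal; apply lf_inj, NNPP; intros ne.
        apply (LW _ _ hr), (BB _ _ _ ne); [left; auto|eauto].
      * exfalso; pose proof (QW _ _ _ hv (hWC v hr)) as e; simpl in e.
        apply (uC0 _ n (proj2_sig j)); unfold u; rewrite <- e; exact hr.
    + assert (Qu : forall (j : J2) n v, In v (Q (lf j) (psi (projT1 (proj1_sig j)) n)) -> W v ->
        in_union_rays V _ RR v).
      { intros j n v hv w; pose proof (QW _ _ _ hv w) as e; simpl in e; rewrite e.
        exists (Some (inl (exist Lam2 (projT1 (proj1_sig j)) (proj2_sig j)))); apply (hCC _ (proj2_sig j)). }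
      intros [[[c hc]|i]|] [[[d hd]|j]|] m n v hi hj ne h1 h2; simpl in *; try congruence.
      * destruct (hd0 c d (N c + m) (N d + n) v) as [l <-]; auto.
        -- intros e; apply ne; do 2 f_equal; apply sig_inj; exact e.
        -- exists None; apply hU0.
      * apply (Qu j n v h2); eauto.
      * apply (Qu i m v h1); eauto.
      * apply (Qu i m v h1), (BB (lf i) (lf j)); eauto.
        intros e; apply ne; do 2 f_equal; apply lf_inj, e.
Qed.

End LinkedHubs.

(* A second application of [many_fans] links the hubs [U c] to a common countable set [U0].
   If many of them meet [U0] infinitely often, then all leaves attach to one ray through [U0];
   otherwise the part of [U c] linked to [U0] is first threaded by a ray of its own, built from
   the spare leaves [(c, (x, S k))]. *)
Lemma singular_uncountable :
  inhabited K -> small_ideal (fun A => lt_card A C) ->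
  exists J : CType, le_card K J /\ connected_rays adj E J.
Proof.
  intros inh siC.
  (* A set of full size in [C] does not fit into the segment below [c0]. *)
  assert (cover : forall Lam' : C -> Prop, ~ lt_card {c | Lam' c} C ->
    forall x, exists c, Lam' c /\ D c x).
  { intros Lam' hl x; destruct (D_cov x) as [c0 hc0]; apply NNPP; intros no; apply hl.
    apply (le_lt_card_trans _ (seg ltC c0)); [|apply ini].
    apply le_card_sub; intros c hc; apply NNPP; intros n; apply no; eauto. }
  destruct (many_fans adj_sym siC r0 C (fun c v => exists n, U c n = v) (fun _ _ => False))
    as [U0 [Lam0 [P0 [hLam0 hsys]]]].
  { intros c; destruct (not_small_inhabited (si c) _ (hLam c)) as [i hi].
    destruct (proj1 (hhub c) i hi) as [hfan _].
    apply (linked_trans adj_sym _ _ (R i)); [eapply end_ray; eauto| |apply (end_linked adj_sym hE), hR].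
    apply (linked_sym adj_sym), (fan_linked adj_sym hfan); intros; exact I. }
  { intros c; exists r0; tauto. }
  { intros A _; apply NNPP; intros n.
    destruct (not_small_inhabited siC _ n) as [i [v [_ []]]]. }
  { intros [_ h]; apply h, le_card_refl. }
  destruct (ray_through (adj := adj) everywhere U0) as [C0 [hC0 [_ hU0]]].
  { intros n; exact I. }
  { apply injective_escapes.
    destruct (not_small_inhabited siC _ hLam0) as [c hc].
    apply (fan_inj (proj1 (proj1 hsys c hc))). }
  { intros Y m n hm hn.
    destruct (not_small_inhabited siC _ (fan_system_avoid siC _ _ _ _ _ (fun v => In v Y) hsys hLam0
                (small_list siC Y))) as [c [hc hav]].
    pose proof (proj1 (proj1 hsys c hc)) as hfan.
    assert (av : forall l v, ~ In (U0 l) Y -> In v (P0 c l) -> everywhere v /\ ~ In v Y).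
    { intros l v hl hv; split; [exact I|]; intros hy.
      destruct (hav v (or_intror (ex_intro _ l hv)) hy) as [q <-].
      apply (fan_meets hfan) in hv; congruence. }
    destruct (fan_first hfan m) as [x [fx [[a <-] _]]], (fan_first hfan n) as [y [fy [[b <-] _]]].
    apply (reach_trans _ _ (U c a)); [|apply (reach_trans _ _ (U c b))].
    - apply (walk_reach adj_sym _ (P0 c m)); eauto.
      + eapply AB_path_walk, hfan.
      + apply (fan_last_in hfan).
      + apply first_vertex_in, fx.
    - apply (hubs_reach adj_sym ray0 hE hR (si c) (si c) _ _ _ _ _ _ Y a b
             (hhub c) (hLam c) (hhub c) (hLam c)).
      + apply (av m); auto; apply first_vertex_in, fx.
      + apply (av n); auto; apply first_vertex_in, fy.
    - apply (walk_reach adj_sym _ (P0 c n)); eauto.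
      + eapply AB_path_walk, hfan.
      + apply first_vertex_in, fy.
      + apply (fan_last_in hfan). }
  pose proof (fan_system_avoid siC _ _ _ _ _ (on_ray C0) hsys hLam0
    (small_countable siC C0 _ (fun v h => h))) as hLam1.
  set (Lam1 := fun c => Lam0 c /\ forall v, body (fun _ _ => False) c (P0 c) v -> on_ray C0 v ->
                 exists n, U0 n = v) in hLam1.
  destruct (choice_fun (fun (p : C * nat) q => Lam1 (fst p) ->
    first_vertex (P0 (fst p) (snd p)) (U (fst p) q))) as [k0 hk0].
  { intros [c n]; destruct (classic (Lam1 c)) as [hc|nc]; [|exists 0; tauto].
    destruct (fan_first (proj1 (proj1 hsys c (proj1 hc))) n) as [x [fx [[a <-] _]]].
    exists a; intros _; exact fx. }
  pose (k := fun c n => k0 (c, n)).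
  assert (hk : forall c n, Lam1 c -> first_vertex (P0 c n) (U c (k c n)))
    by (intros c n; exact (hk0 (c, n))).
  clearbody k; clear k0 hk0.
  (* Leaf bodies may meet the centre, the hubs and the linking paths only in the last vertices of
     their own paths. [W] is small for every stage because [C] is. *)
  pose (W := fun v => on_ray C0 v \/ (exists c n, U c n = v) \/ exists c n, In v (P0 c n)).
  destruct (disjoint_leaves hR (proj1 ini) _ si U Lam P hhub hLam earlier W)
    as [L [Q [hL [hf [LW [QW BB]]]]]].
  { intros c; apply (small_or (si c)); [|apply (small_or (si c))].
    - apply (small_countable (si c) C0); auto.
    - apply (small_union (si c)); auto; intros d; apply (small_countable (si c) (U d)); auto.
    - apply (small_union (si c)); auto; intros d; apply (small_union (si c)).
      + apply (small_nat _ (si c)).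
      + intros n; apply (small_list (si c)). }
  { intros c n; right; left; eauto. }
  assert (hf0 : forall c, Lam1 c -> fan (adj := adj) (fun v => exists n, U c n = v) U0 (P0 c))
    by (intros c hc; apply (proj1 hsys c (proj1 hc))).
  assert (hd0 : forall c d m n v, Lam1 c -> Lam1 d -> c <> d -> In v (P0 c m) -> In v (P0 d n) ->
     exists l, U0 l = v).
  { intros c d m n v hc hd ne h1 h2; apply (proj2 hsys c d); [apply hc|apply hd|auto| |]; right; eauto. }
  assert (hC0P : forall c n v, Lam1 c -> In v (P0 c n) -> on_ray C0 v -> exists m, U0 m = v).
  { intros c n v hc hv; apply hc; right; eauto. }
  pose (often := fun c => forall N, exists n, N <= n /\ U c (k c n) = U0 n).
  destruct (classic (lt_card {c | Lam1 c /\ often c} C)) as [few|many].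
  - assert (many : ~ lt_card {c | Lam1 c /\ ~ often c} C).
    { intros h; apply (not_small_diff siC Lam1 _ hLam1 few).
      eapply (small_sub siC); [|exact h]; simpl; tauto. }
    destruct (choice_fun (fun c N => Lam1 c /\ ~ often c -> forall n, N <= n -> U c (k c n) <> U0 n))
      as [N hN].
    { intros c; destruct (classic (often c)) as [o|o]; [exists 0; tauto|].
      apply not_all_ex_not in o; destruct o as [N hN]; exists N.
      intros _ n hn e; apply hN; eauto. }
    apply (two_level (W := W) hC0 hU0 hf0 hd0 hC0P hk) with
      (L := L) (Q := Q) (Lam2 := fun c => Lam1 c /\ ~ often c) (N := N); auto.
    + intros v h; left; exact h.
    + intros c n; right; left; eauto.
    + intros c n v h; right; right; eauto.
    + intros c h; apply h.
  - destruct (choice_fun (fun c (s : nat -> nat) => Lam1 c /\ often c ->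
      (forall m n, s m = s n -> m = n) /\ forall n, U c (k c (s n)) = U0 (s n))) as [s hs].
    { intros c; destruct (classic (often c)) as [o|o]; [|exists (fun n => n); tauto].
      destruct (injective_subsequence _ o) as [s hs]; exists s; auto. }
    apply (one_level (W := W) hC0 hU0 hf0 hk) with
      (L := L) (Q := Q) (Lam2 := fun c => Lam1 c /\ often c) (s := s); auto.
    + intros v h; left; exact h.
    + intros c n; right; left; eauto.
    + intros c h; apply h.
Qed.

End Singular.

(** * Countable end degrees *)

Lemma list_filter {I : Type} (Q : I -> Prop) (l : list I) :
  exists T, forall t, In t T <-> In t l /\ Q t.
Proof.
  induction l as [|a l [T hT]].
  - exists []; simpl; tauto.
  - destruct (classic (Q a)) as [h|h].
    + exists (a :: T); intros t; simpl; rewrite hT; split; [|tauto].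
      intros [<-|k]; tauto.
    + exists T; intros t; simpl; rewrite hT; split; [tauto|].
      intros [[<-|k] q]; tauto.
Qed.

Lemma list_uniform {I A B : Type} (Phi : I -> list A -> list B -> Prop) (l : list I) :
  (forall t X X' Y Y', incl X X' -> incl Y Y' -> Phi t X Y -> Phi t X' Y') ->
  (forall t, In t l -> exists X Y, Phi t X Y) -> exists X Y, forall t, In t l -> Phi t X Y.
Proof.
  intros mono; induction l as [|a l IH]; intros h.
  - exists [], []; intros t [].
  - destruct IH as [X [Y hXY]]; [intros t ht; apply h; simpl; auto|].
    destruct (h a) as [X' [Y' h']]; [simpl; auto|].
    exists (X' ++ X), (Y' ++ Y); intros t [<-|ht].
    + eapply mono; [| |exact h']; apply incl_appl, incl_refl.
    + eapply mono; [| |apply (hXY t ht)]; apply incl_appr, incl_refl.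
Qed.

Definition unbounded {I : Type} (J : I -> Prop) : Prop := forall Y : list I, exists k, J k /\ ~ In k Y.

Lemma unbounded_injective {I : Type} (J : I -> Prop) (k : nat -> I) :
  (forall m n, k m = k n -> m = n) -> (forall n, J (k n)) -> unbounded J.
Proof. intros inj h Y; destruct (injective_escapes k inj Y) as [n hn]; eauto. Qed.

Lemma unbounded_infinite {I : Type} (J : I -> Prop) : unbounded J -> infinite_type {i | J i}.
Proof.
  intros h; apply NNPP; intros fin; destruct (finite_of_not_infinite _ fin) as [l hl].
  destruct (h (map (@proj1_sig _ _) l)) as [k [hk nk]]; apply nk.
  apply (in_map (@proj1_sig _ _) l (exist _ k hk)), hl.
Qed.

Section Countable.
Context {V : CType} {adj : V -> V -> Prop} (adj_sym : forall x y, adj x y -> adj y x).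
Context {E : (nat -> V) -> Prop} {r0 : nat -> V} (ray0 : is_ray adj r0)
  (hE : forall r, E r <-> is_ray adj r /\ equiv_rays adj r r0).
Context {I : CType} {R : I -> nat -> V} (hR : forall i, E (R i)) (dis : disjoint_ray_family R).

Definition avoids (D : I -> Prop) (i j : I) (v : V) : Prop :=
  forall k, D k -> on_ray (R k) v -> k = i \/ k = j.

(** Adjacency depends on the family: only the other rays of [D] are avoided, so passing to a
    subfamily keeps edges ([edge_mono]) and may create new ones. *)
Definition edge (D : I -> Prop) (i j : I) : Prop :=
  D i /\ D j /\ i <> j /\ linked (adj := adj) (avoids D i j) (on_ray (R i)) (on_ray (R j)).

Lemma ray_index_eq i j v : on_ray (R i) v -> on_ray (R j) v -> i = j.
Proof. intros h1 h2; apply NNPP; intros ne; exact (dis i j ne v h1 h2). Qed.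

Lemma edge_sym D i j : edge D i j -> edge D j i.
Proof.
  intros (h1 & h2 & h3 & h4); repeat (split; auto).
  apply (linked_sym adj_sym); eapply linked_mono; [| | |exact h4]; auto.
  intros v hv k h5 h6; destruct (hv k h5 h6); auto.
Qed.

Lemma edge_mono (D D' : I -> Prop) i j :
  (forall k, D' k -> D k) -> D' i -> D' j -> edge D i j -> edge D' i j.
Proof.
  intros h hi hj (_ & _ & h3 & h4); repeat (split; auto).
  eapply linked_mono; [| | |exact h4]; auto; intros v hv k h5; apply hv; auto.
Qed.

Definition joining (D : I -> Prop) (i j : I) (p : list V) : Prop :=
  AB_path adj (on_ray (R i)) (on_ray (R j)) p /\ forall v, In v p -> avoids D i j v.

Lemma joining_reach (S : V -> Prop) D i j p :
  joining D i j p -> (forall v, In v p -> S v) ->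
  exists m n, reach (adj := adj) S (R i m) (R j n) /\ S (R i m) /\ S (R j n).
Proof.
  intros [hp _] hS; destruct (AB_path_first _ _ _ hp) as [x [hx [m <-]]].
  destruct (AB_path_last _ _ _ hp) as [y [hy [n <-]]].
  apply first_vertex_in in hx; apply last_vertex_in in hy.
  exists m, n; split; auto; apply (walk_reach adj_sym _ p); auto; eapply AB_path_walk; eauto.
Qed.

(* A finite subfamily [T] of [D] cannot be finitely separated from the rest of [D]; by
   pigeonhole the connecting paths either accumulate at one ray or spread out over many. *)
Lemma edge_or_spread (D : I -> Prop) (T : list I) :
  (forall t, In t T -> D t) -> T <> [] -> (exists d, D d /\ ~ In d T) ->
  (exists t k, In t T /\ ~ In k T /\ edge D t k) \/
  (exists t, In t T /\ forall X Y, exists k p, D k /\ ~ In k T /\ ~ In k Y /\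
     joining D t k p /\ forall v, In v p -> ~ In v X).
Proof.
  intros hT ne [d [hd nd]].
  destruct (classic (exists t k, In t T /\ ~ In k T /\ edge D t k)) as [h|no1]; auto.
  right; apply NNPP; intros no2.
  (* If nothing spreads, finite [X0] and [Y0] are found such that [X0] meets all joining paths from
     [T] to rays outside [Y0]; without edges, a finite [X1] meets those to rays in [Y0]. The end has
     a path avoiding both. *)
  destruct (list_uniform (fun t X Y => forall k p, D k -> ~ In k T -> ~ In k Y ->
     joining D t k p -> exists v, In v p /\ In v X) T) as [X0 [Y0 h0]].
  { intros t X X' Y Y' h1 h2 h k p a b c e; destruct (h k p) as [v [hv hx]]; auto; eauto. }
  { intros t ht; apply NNPP; intros n; apply no2; exists t; split; auto; intros X Y.
    apply NNPP; intros n'; apply n; exists X, Y; intros k p a b c e.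
    apply NNPP; intros n''; apply n'; exists k, p; repeat (split; auto).
    intros v hv hx; apply n''; eauto. }
  destruct (list_uniform (fun (q : I * I) (X : list V) (_ : list unit) =>
     In (fst q) T -> D (snd q) -> ~ In (snd q) T ->
     forall p, joining D (fst q) (snd q) p -> exists v, In v p /\ In v X) (list_prod T Y0))
    as [X1 [_ h1]].
  { intros t X X' Y Y' h1 _ h a b c p e; destruct (h a b c p e) as [v [hv hx]]; eauto. }
  { intros [t k] _; simpl; apply NNPP; intros n.
    destruct (classic (In t T /\ D k /\ ~ In k T)) as [[a [b c]]|n'];
      [|apply n; exists [], []; intros; tauto].
    apply no1; exists t, k; split; auto; split; auto; split; [auto|split; [auto|split]].
    - intros ->; auto.
    - intros X; apply NNPP; intros n'; apply n; exists X, []; intros _ _ _ p hp.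
      apply NNPP; intros n''; apply n'.
      destruct (joining_reach (fun v => avoids D t k v /\ ~ In v X) D t k p hp) as [i [j [hr _]]].
      + intros v hv; split; [apply hp, hv|]; intros hx; apply n''; eauto.
      + exists (R t i), (R k j); split; [exists i; auto|split; [exists j; auto|exact hr]]. }
  destruct T as [|t0 T0]; [congruence|]; set (T := t0 :: T0) in *.
  destruct (end_linked2 adj_sym ray0 hE _ _ (hR t0) (hR d) (X0 ++ X1)) as [a [b [ha [hb hr]]]].
  assert (hA : exists t, In t T /\ on_ray (R t) a) by (exists t0; split; auto; left; auto).
  assert (hB : exists k, D k /\ ~ In k T /\ on_ray (R k) b) by eauto.
  destruct (AB_path_of_reach _ (fun v => exists t, In t T /\ on_ray (R t) v)
     (fun v => exists k, D k /\ ~ In k T /\ on_ray (R k) v) a b hA hB hr) as [p [hp hav]].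
  destruct hp as [hp (x & y & fx & ly & [t [ht hx]] & [k [hk [nk hy]]] & h5 & h6)].
  assert (hj : joining D t k p).
  { split; [split; auto; exists x, y; repeat (split; auto)|].
    - intros v hv hr'; apply h5; eauto.
    - intros v hv hr'; apply h6; eauto.
    - intros v hv l hl hr'; destruct (classic (In l T)) as [i|i].
      + left; apply (ray_index_eq _ _ x); auto; rewrite <- (h5 v hv); eauto.
      + right; apply (ray_index_eq _ _ y); auto; rewrite <- (h6 v hv); eauto. }
  destruct (classic (In k Y0)) as [i|i].
  - destruct (h1 (t, k)) with (p := p) as [v [h7 h8]]; auto.
    + apply in_prod; auto.
    + apply (hav v h7), in_app_iff; auto.
  - destruct (h0 t ht k p hk nk i hj) as [v [h7 h8]].
    apply (hav v h7), in_app_iff; auto.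
Qed.

Lemma spread_sequence (D M : I -> Prop) t :
  (forall X Y, exists k p, M k /\ ~ In k Y /\ joining D t k p /\ forall v, In v p -> ~ In v X) ->
  exists (k : nat -> I) (p : nat -> list V), (forall n, M (k n)) /\ (forall n, joining D t (k n) (p n)) /\
    (forall m n, k m = k n -> m = n) /\ (forall m n v, In v (p m) -> In v (p n) -> m = n).
Proof.
  intros h.
  destruct (history_choice (fun (_ : nat) (L : list (I * list V)) q =>
    M (fst q) /\ ~ In (fst q) (map fst L) /\ joining D t (fst q) (snd q) /\
    forall v, In v (snd q) -> ~ In v (concat (map snd L)))) as [s [L hs]].
  { intros _ L; destruct (h (concat (map snd L)) (map fst L)) as [k [p hp]]; exists (k, p); exact hp. }
  exists (fun n => fst (s n)), (fun n => snd (s n)); split; [|split; [|split]].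
  - intros n; apply hs.
  - intros n; apply hs.
  - assert (lt : forall m n, m < n -> fst (s m) <> fst (s n)).
    { intros m n hl e; destruct (hs n) as [(_ & a & _) b]; apply a.
      rewrite <- e; apply in_map, b, hl. }
    intros m n e; destruct (lt_eq_lt_dec m n) as [[q|q]|q]; auto.
    + destruct (lt m n q e).
    + destruct (lt n m q (eq_sym e)).
  - assert (lt : forall m n v, m < n -> In v (snd (s m)) -> ~ In v (snd (s n))).
    { intros m n v hl h1 h2; destruct (hs n) as [(_ & _ & _ & a) b]; apply (a v h2).
      apply in_concat; exists (snd (s m)); split; auto; apply in_map, b, hl. }
    intros m n v h1 h2; destruct (lt_eq_lt_dec m n) as [[q|q]|q]; auto.
    + destruct (lt m n v q h1 h2).
    + destruct (lt n m v q h2 h1).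
Qed.

(** Step [n] serves the pair whose code is the first component of [n], so each of the countably many
    edges is served infinitely often, and all paths are disjoint, hence independent. *)
Lemma connected_rays_of_edges (D : I -> Prop) :
  le_card {i | D i} nat -> (forall i j, D i -> D j -> clos_refl_trans I (edge D) i j) ->
  connected_rays adj E {i | D i}.
Proof.
  intros cnt conn; set (J := {i | D i}).
  exists (fun j : J => R (proj1_sig j)); split; [auto|split].
  { intros i j ne; apply dis; intros e; apply ne, sig_inj, e. }
  pose (H := fun a b : J => edge D (proj1_sig a) (proj1_sig b)).
  exists H; split; [split; [|split]|].
  - intros x y; apply edge_sym.
  - intros x (_ & _ & h & _); auto.
  - assert (h : forall i j, clos_refl_trans_1n I (edge D) i j -> forall hi hj,
      clos_refl_trans J H (exist _ i hi) (exist _ j hj)).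
    { intros i j h; induction h as [i|i k j h1 h2 IH]; intros hi hj.
      - replace hj with hi by apply proof_irrelevance; apply rt_refl.
      - eapply rt_trans; [apply rt_step|apply (IH (proj1 (proj2 h1)))]; exact h1. }
    intros [i hi] [j hj]; apply h, clos_rt_rt1n, conn; auto.
  - assert (cnt2 : le_card (J * J) nat).
    { eapply le_card_trans; [apply (le_card_prod _ _ _ _ cnt cnt)|apply le_card_nat_prod]. }
    destruct cnt2 as [f hf].
    destruct (disjoint_sequence (fun n p => forall a b, f (a, b) = fst (Cantor.of_nat n) -> H a b ->
      joining D (proj1_sig a) (proj1_sig b) p)) as [P [hP hd]].
    { intros n X.
      destruct (classic (exists a b, f (a, b) = fst (Cantor.of_nat n) /\ H a b)) as [[a [b [e h]]]|no].
      - pose proof h as (_ & _ & _ & hl).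
        destruct (hl X) as [x [y [hx [hy hr]]]].
        destruct (AB_path_of_reach _ _ _ _ _ hx hy hr) as [p [hp hS]]; exists p; split.
        + intros a' b' e' _; rewrite <- e in e'; apply hf in e'; inversion e'; subst a' b'.
          split; auto; intros v hv; apply hS, hv.
        + intros v hv; apply hS, hv.
      (* Steps that code no edge take the empty list, which is kept out of the path set below. *)
      - exists []; split; [|intros v []]; intros a b e h; destruct no; eauto. }
    exists (fun p => exists n a b, p = P n /\ f (a, b) = fst (Cantor.of_nat n) /\ H a b).
    split; [|split].
    + intros p [n [a [b [-> [e h]]]]].
      destruct (hP n a b e h) as [[hp (x & y & fx & ly & hx & hy & h5 & h6)] hav].
      split; auto; exists x, y; split; [auto|split; [auto|split]].
      * intros ->; destruct h as (_ & _ & ne & _); apply ne; eapply ray_index_eq; eauto.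
      * intros v hv; split.
        -- intros [c hc]; destruct (hav v hv _ (proj2_sig c) hc) as [q|q];
             rewrite q in hc; auto.
        -- intros [->| ->]; [exists a|exists b]; auto.
    + intros p q [m [a [b [-> _]]]] [n [c [d [-> _]]]] ne v [h1 _]; apply (hd m n); auto; congruence.
    + intros a b h; exists (fun n => P (Cantor.to_nat (f (a, b), n))); split.
      * intros n; split.
        -- exists (Cantor.to_nat (f (a, b), n)), a, b; rewrite Cantor.cancel_of_to; auto.
        -- destruct (hP (Cantor.to_nat (f (a, b), n)) a b) as [[_ (x & y & q)] _]; auto.
           { rewrite Cantor.cancel_of_to; auto. }
           exists x, y; tauto.
      * intros m n ne; apply hd; intros e; apply Cantor.to_nat_inj in e; congruence.
Qed.

(** Spreading is impossible in a finite family, so a component missing some ray would have an edge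
    leaving it. *)
Lemma connected_rays_finite (l : list I) :
  (forall i, In i l) -> connected_rays adj E {i : I | True}.
Proof.
  intros hl; apply connected_rays_of_edges.
  { eapply le_card_trans; [apply le_card_sig|apply (le_card_list I l hl)]. }
  intros i j _ _; apply NNPP; intros no.
  destruct (list_filter (clos_refl_trans I (edge (fun _ => True)) i) l) as [T hT].
  destruct (edge_or_spread (fun _ => True) T) as [[t [k [ht [nk he]]]]|[t [ht h]]]; auto.
  - intros e; assert (In i T) by (apply hT; split; auto; apply rt_refl); subst T; auto.
  - exists j; split; auto; intros hj; apply no, hT, hj.
  - apply nk, hT; split; auto; eapply rt_trans; [apply hT, ht|apply rt_step, he].
  - destruct (h [] l) as [k [p [_ [_ [nk _]]]]]; auto.
Qed.

Definition connected_family (D : I -> Prop) : Prop :=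
  unbounded D /\ forall i j, D i -> D j -> clos_refl_trans I (edge D) i j.

(** [F] is already built, [J] is the reservoir; rays discarded from it become routes for paths. If
    [f] in [F] spreads over rays [k n], consider the component of [k 0] among these. If infinite, it
    is a connected family. Otherwise it has an edge to [F], or a member [e] that again spreads over
    rays [k n], and discarding half of the rays so reached joins [e] to [f]. *)
Lemma extend_family (F : list I) (J : I -> Prop) :
  F <> [] -> unbounded J -> (forall k, In k F -> ~ J k) ->
  (exists D, connected_family D) \/
  exists (J' : I -> Prop) j f, unbounded J' /\ (forall k, J' k -> J k) /\ J' j /\ In f F /\
    edge (fun k => In k F \/ J' k) f j.
Proof.
  intros nF infJ dFJ; set (D := fun k => In k F \/ J k).
  destruct (edge_or_spread D F) as [[f [j [hf [nj he]]]]|[f [hf spread]]].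
  { left; auto. }
  { auto. }
  { destruct (infJ F) as [k [h1 h2]]; exists k; split; auto; right; auto. }
  { right; exists J, j, f; repeat (split; auto); destruct he as (_ & [h|h] & _); auto; contradiction. }
  destruct (spread_sequence D (fun k => D k /\ ~ In k F) f) as [k [p [hk [hp [kinj pdis]]]]].
  { intros X Y; destruct (spread X Y) as [k [p (a & b & c & d)]]; exists k, p; auto. }
  assert (kJ : forall n, J (k n)) by (intros n; destruct (hk n) as [[h|h] n']; auto; contradiction).
  pose (J1 := fun x => exists n, k n = x); pose (D1 := fun x => In x F \/ J1 x).
  assert (J1J : forall x, J1 x -> J x) by (intros x [n <-]; auto).
  assert (infJ1 : unbounded J1) by (apply (unbounded_injective J1 k kinj); intros n; exists n; auto).
  pose (E1 := clos_refl_trans I (fun a b => edge D1 a b /\ J1 a /\ J1 b) (k 0)).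
  assert (E1J1 : forall x, E1 x -> J1 x).
  { intros x h; apply clos_rt_rtn1 in h; destruct h as [|y z [_ [_ h]]]; auto; exists 0; auto. }
  destruct (classic (unbounded E1)) as [inf|fin].
  { left; exists E1; split; auto.
    assert (from : forall x, E1 x -> clos_refl_trans I (edge E1) (k 0) x).
    { intros x h; pose proof h as h'; apply clos_rt_rtn1 in h'.
      induction h' as [|y z h1 h2 IH]; [apply rt_refl|].
      assert (Ey : E1 y) by (apply clos_rtn1_rt; auto).
      eapply rt_trans; [apply IH; auto|apply rt_step].
      apply (edge_mono D1); auto; [|apply h1]; intros q hq; right; auto. }
    assert (back : forall x y, clos_refl_trans I (edge E1) x y -> clos_refl_trans I (edge E1) y x).
    { intros x y h; induction h; [apply rt_step, edge_sym; auto|apply rt_refl|eapply rt_trans; eauto]. }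
    intros i j hi hj; eapply rt_trans; [apply back|]; apply from; auto. }
  apply not_all_ex_not in fin; destruct fin as [Y hY].
  assert (E1Y : forall x, E1 x -> In x Y) by (intros x h; apply NNPP; intros n; apply hY; eauto).
  destruct (list_filter E1 Y) as [T hT].
  assert (TE : forall x, In x T <-> E1 x) by (intros x; rewrite hT; split; [tauto|auto]).
  assert (dF : forall x, In x F -> ~ In x T).
  { intros x h h'; apply (dFJ x h), J1J, E1J1, TE, h'. }
  right; destruct (edge_or_spread D1 T) as [[e [j [he [nj hej]]]]|[e [he spread']]].
  { intros t ht; right; apply E1J1, TE, ht. }
  { intros e; assert (h : In (k 0) T) by (apply TE, rt_refl); rewrite e in h; destruct h. }
  { exists f; split; [left; auto|auto]. }
  { exists J1, e, j; split; [auto|split; [auto|split; [apply E1J1, TE, he|]]].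
    pose proof hej as (_ & [h|h] & _); [split; [auto|apply edge_sym; exact hej]|].
    exfalso; apply nj, TE; eapply rt_trans; [apply TE, he|apply rt_step].
    split; [exact hej|split; [apply E1J1, TE, he|exact h]]. }
  destruct (spread_sequence D1 (fun q => J1 q /\ ~ In q T) e) as [k' [q [hk' [hq [kinj' qdis]]]]].
  { intros X Y'; destruct (spread' X (Y' ++ F)) as [l [p' (a & b & c & d)]]; exists l, p'.
    rewrite in_app_iff in c; split; [|tauto]; destruct a; tauto. }
  destruct (choice_fun (fun m n => k n = k' m)) as [nn hnn]; [intros m; apply hk'|].
  (* Even indices stay in the reservoir. For odd [m] the route from [e] to [f] is [q m], then the
     ray [k' m], then [p (nn m)] backwards. *)
  pose (J' := fun x => x = e \/ exists m, x = k' (2 * m)).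
  assert (eJ1 : J1 e) by (apply E1J1, TE, he).
  assert (J'J1 : forall x, J' x -> J1 x).
  { intros x [->|[m ->]]; auto; apply hk'. }
  assert (odd_out : forall m, ~ (In (k' (2 * m + 1)) F \/ J' (k' (2 * m + 1)))).
  { intros m [h|[h|[i h]]].
    - apply (dFJ _ h), J1J, hk'.
    - apply (proj2 (hk' (2 * m + 1))); rewrite h; auto.
    - apply kinj' in h; lia. }
  exists J', e, f; split; [|split; [auto|split; [left; auto|split; [auto|]]]].
  { apply (unbounded_injective J' (fun m => k' (2 * m))).
    - intros m n h; apply kinj' in h; lia.
    - intros m; right; exists m; auto. }
  assert (nef : e <> f) by (intros ->; apply (dFJ f hf); auto).
  apply edge_sym; split; [right; left; auto|split; [left; auto|split; [auto|]]].
  intros X.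
  destruct (eventually_avoid (fun m v => In v (q m))) with (X := X) as [N1 h1]; [exact qdis|].
  destruct (eventually_avoid (fun m v => on_ray (R (k' m)) v)) with (X := X) as [N2 h2].
  { intros m n v a b; apply kinj'; eapply ray_index_eq; eauto. }
  destruct (eventually_avoid (fun m v => In v (p (nn m)))) with (X := X) as [N3 h3].
  { intros m n v a b; pose proof (pdis _ _ _ a b) as h; apply kinj'; rewrite <- !hnn, h; auto. }
  (* An odd index past all three bounds: both paths and the ray between them avoid [X]. *)
  pose (N := max N1 (max N2 N3)); pose (m := 2 * N + 1).
  set (S := fun v => avoids (fun k => In k F \/ J' k) e f v /\ ~ In v X).
  assert (sq : forall v, In v (q m) -> S v).
  { intros v hv; split; [|apply (h1 m); auto; unfold m, N; lia].
    intros l hl hr; destruct (proj2 (hq m) v hv l) with (2 := hr) as [->| ->]; auto.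
    - destruct hl as [hl|hl]; [left; auto|right; auto].
    - destruct (odd_out N hl). }
  assert (sp : forall v, In v (p (nn m)) -> S v).
  { intros v hv; split; [|apply (h3 m); auto; unfold m, N; lia].
    intros l hl hr; destruct (proj2 (hp (nn m)) v hv l) with (2 := hr) as [->| ->]; auto.
    - destruct hl as [hl|hl]; [left; auto|right; auto].
    - rewrite hnn in hl; destruct (odd_out N hl). }
  assert (sr : forall i, S (R (k' m) i)).
  { intros i; split; [|apply (h2 m); [unfold m, N; lia|exists i; auto]].
    intros l hl hr; exfalso; apply (odd_out N); fold m.
    rewrite (ray_index_eq (k' m) l (R (k' m) i)); auto; exists i; auto. }
  destruct (joining_reach S D1 e (k' m) (q m) (hq m) sq) as [a [b [r1 _]]].
  destruct (joining_reach S D f (k (nn m)) (p (nn m)) (hp (nn m)) sp) as [c [d [r2 _]]].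
  rewrite hnn in r2.
  exists (R e a), (R f c); split; [exists a; auto|split; [exists c; auto|]].
  eapply reach_trans; [exact r1|]; eapply reach_trans; [|apply (reach_sym adj_sym), r2].
  apply (ray_reach adj_sym S (R (k' m)) 0); auto; [eapply end_ray; eauto|lia|lia].
Qed.

Lemma connected_family_exists : infinite_type I -> exists D, connected_family D.
Proof.
  intros [g ginj]; apply NNPP; intros no.
  (* The finite part is connected relative to itself together with the whole reservoir, so it stays
     connected when the reservoir shrinks. *)
  pose (ok := fun s : list I * (I -> Prop) => fst s <> [] /\ NoDup (fst s) /\ unbounded (snd s) /\
    (forall k, In k (fst s) -> ~ snd s k) /\
    forall x y, In x (fst s) -> In y (fst s) -> clos_refl_trans I
      (fun a b => edge (fun k => In k (fst s) \/ snd s k) a b /\ In a (fst s) /\ In b (fst s)) x y).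
  assert (step : forall s : {s | ok s}, exists s' : {s | ok s},
    (exists j, fst (proj1_sig s') = j :: fst (proj1_sig s) /\ snd (proj1_sig s) j) /\
    (forall k, snd (proj1_sig s') k -> snd (proj1_sig s) k)).
  { intros [[F J] hok]; pose proof hok as (nF & ndF & infJ & dFJ & conn); simpl in *.
    destruct (extend_family F J nF infJ dFJ) as [h|[J' [j [f (a & b & c & d & e)]]]]; [contradiction|].
    set (J2 := fun k => J' k /\ k <> j); set (F2 := j :: F).
    assert (sub : forall k, In k F2 \/ J2 k -> In k F \/ J' k).
    { intros k [[<-|h]|[h _]]; auto. }
    assert (ok2 : ok (F2, J2)).
    { split; [discriminate|split; [|split; [|split]]]; simpl.
      - constructor; auto; intros h; exact (dFJ j h (b j c)).
      - intros Y; destruct (a (j :: Y)) as [k [h1 h2]]; simpl in h2; exists k; split; [split; auto|auto].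
      - intros k [<-|h] [h1 h2]; auto; exact (dFJ k h (b k h1)).
      - set (Rel := fun a b => edge (fun k => In k F2 \/ J2 k) a b /\ In a F2 /\ In b F2).
        assert (old : forall x y, In x F -> In y F -> clos_refl_trans I Rel x y).
        { intros x y hx hy; specialize (conn x y hx hy).
          induction conn as [x y [h1 [h2 h3]]|x|x y z h1 IH1 h2 IH2].
          - apply rt_step; split; [|split; right; auto].
            apply (edge_mono (fun k => In k F \/ J k)); auto; try (left; right; auto).
            intros k h; destruct (sub k h); auto.
          - apply rt_refl.
          - assert (hy' : In y F).
            { apply clos_rt_rtn1 in h1; destruct h1 as [|u w [_ [_ h]]]; auto. }
            eapply rt_trans; auto. }
        assert (fj : edge (fun k => In k F2 \/ J2 k) f j).
        { apply (edge_mono (fun k => In k F \/ J' k)); auto; left; [right|left]; auto. }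
        assert (F2f : In f F2) by (right; auto).
        assert (F2j : In j F2) by (left; auto).
        intros x y [<-|hx] [<-|hy]; auto.
        + apply rt_refl.
        + eapply rt_trans; [apply rt_step|apply (old f y)]; auto; split; auto; apply edge_sym, fj.
        + eapply rt_trans; [apply (old x f)|apply rt_step]; auto; split; auto. }
    exists (exist _ _ ok2); simpl; split; [exists j; auto|intros k [h _]; auto]. }
  destruct (choice_fun _ step) as [nx hnx].
  assert (ok0 : ok ([g 0], fun k => k <> g 0)).
  { split; [discriminate|split; [|split; [|split]]]; simpl.
    - constructor; [intros []|constructor].
    - intros Y; destruct (injective_escapes g ginj (g 0 :: Y)) as [n hn]; simpl in hn.
      exists (g n); split; auto.
    - intros k [<-|[]] h; auto.
    - intros x y [<-|[]] [<-|[]]; apply rt_refl. }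
  pose (s := fix s n := match n with 0 => exist ok _ ok0 | S n => nx (s n) end).
  pose (F := fun n => fst (proj1_sig (s n))); pose (J := fun n => snd (proj1_sig (s n))).
  assert (hok : forall n, ok (F n, J n)).
  { intros n; unfold F, J; rewrite <- surjective_pairing; apply (proj2_sig (s n)). }
  assert (hF : forall n, exists j, F (S n) = j :: F n /\ J n j) by (intros n; apply (hnx (s n))).
  assert (hJ : forall n k, J (S n) k -> J n k) by (intros n; apply (hnx (s n))).
  assert (Fup : forall m n, m <= n -> forall x, In x (F m) -> In x (F n)).
  { intros m n h; induction h as [|n h IH]; auto; intros x hx.
    destruct (hF n) as [j [-> _]]; right; auto. }
  assert (Jup : forall m n, m <= n -> forall x, J n x -> J m x).
  { intros m n h; induction h as [|n h IH]; auto. }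
  assert (later : forall n m, n <= m -> forall x, In x (F m) -> In x (F n) \/ J n x).
  { intros n m h; induction h as [|m h IH]; auto; intros x hx.
    destruct (hF m) as [j [e hj]]; rewrite e in hx; destruct hx as [<-|hx]; auto.
    right; eapply Jup; eauto. }
  apply no; exists (fun x => exists n, In x (F n)); split.
  - intros Y; apply NNPP; intros n.
    assert (h : forall m, length (F m) <= length Y).
    { intros m; apply NoDup_incl_length; [apply hok|].
      intros x hx; apply NNPP; intros nx'; apply n; exists x; eauto. }
    assert (len : forall m, length (F m) = S m).
    { induction m as [|m IH]; auto; destruct (hF m) as [j [-> _]]; simpl; auto. }
    specialize (h (length Y)); rewrite len in h; lia.
  - intros x y [m hx] [n hy]; set (q := max m n).
    destruct (hok q) as (_ & _ & _ & _ & conn).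
    assert (hx' : In x (F q)) by (apply (Fup m); auto; unfold q; lia).
    assert (hy' : In y (F q)) by (apply (Fup n); auto; unfold q; lia).
    specialize (conn x y hx' hy'); clear hx hy hx' hy'; simpl in conn.
    induction conn as [x y [h1 [h2 h3]]|x|x y z h1 IH1 h2 IH2].
    (* Rays added after stage [q] come from its reservoir, so the edges of that stage survive in the
       union of all [F n]. *)
    + apply rt_step, (edge_mono (fun k => In k (F q) \/ J q k)); eauto.
      intros k [l hl]; destruct (le_lt_dec q l) as [i|i]; [apply (later q l); auto|].
      left; apply (Fup l); auto; lia.
    + apply rt_refl.
    + eapply rt_trans; eauto.
Qed.

End Countable.

(** * Cofinal scales of a singular cardinal *)

Section Cofinal.
Context {K C : CType} {lt : K -> K -> Prop} {f : C -> K} {ltC : C -> C -> Prop}.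
Context (gch : GCH) (ini : initial_order lt) (unc : ~ le_card K nat)
  (cof : cofinal lt (fun k => exists c, f c = k))
  (min : forall (D : CType) (g : D -> K),
      cofinal lt (fun k => exists d, g d = k) -> le_card C D)
  (iniC : initial_order ltC) (sing : lt_card C K).

(** The union over all $c'\le c$ makes the scale increasing even if [f] is not. *)
Definition below (c : C) (x : K) : Prop := exists c', ~ ltC c c' /\ ~ lt (f c') x.

(** Smaller than [K], but large enough for the ideal of its power set to contain [C] and all leaf
    indices up to stage [c]; the last factor makes it infinite. *)
Definition bound (c : C) : CType := ((C * ({x | below c x} * nat)) * nat)%type.

Lemma below_self c : below c (f c).
Proof. exists c; split; apply swo_irrefl; [apply iniC|apply ini]. Qed.

Lemma below_cover x : exists c0, forall c, ~ ltC c c0 -> below c x.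
Proof. destruct (cof x) as [k [[c0 <-] h]]; exists c0; intros c hc; exists c0; auto. Qed.

Lemma bound_infinite c : infinite_type (bound c).
Proof.
  exists (fun n => ((c, (exist _ (f c) (below_self c), 0)), n)).
  intros m n e; inversion e; auto.
Qed.

Lemma bound_lt c : lt_card (bound c) K.
Proof.
  assert (inf : infinite_type K) by (destruct (le_card_total nat K); tauto).
  assert (hn : lt_card nat K) by (apply not_le_lt_card, unc).
  assert (hD : lt_card {x | below c x} K).
  { destruct (cofinality_initial_bounded ini inf cof min iniC c) as [y hy].
    apply (le_lt_card_trans _ (seg lt y)); [|apply ini].
    apply le_card_sub; intros x [c' [h1 h2]].
    eapply (swo_le_lt (proj1 ini)); [exact h2|apply hy, h1]. }
  unfold bound; repeat apply lt_card_prod; auto.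
Qed.

Lemma not_small_bound c : ~ le_card K (bound c -> Prop).
Proof.
  assert (inf : infinite_type K) by (destruct (le_card_total nat K); tauto).
  apply (gch_singular_strong_limit ini inf cof (bound c) gch sing (bound_infinite c) (bound_lt c)).
Qed.

Lemma small_bound_cofinality c : le_card C (bound c -> Prop).
Proof.
  eapply le_card_trans; [|apply lt_card_power].
  exists (fun c' => ((c', (exist _ (f c) (below_self c), 0)), 0)).
  intros m n e; inversion e; auto.
Qed.

Lemma small_bound_earlier c :
  le_card {j : {c : C & ({x | below c x} * nat)%type} | ~ ltC c (projT1 j)} (bound c -> Prop).
Proof.
  eapply le_card_trans; [|apply lt_card_power].
  assert (mono : forall c' x, ~ ltC c c' -> below c' x -> below c x).
  { intros c' x h [d [h1 h2]]; exists d; split; auto; intros h3.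
    destruct (swo_total (proj1 iniC) c' c) as [q|[->|q]]; auto.
    apply h1; eapply (swo_trans (proj1 iniC)); eauto. }
  exists (fun j => ((projT1 (proj1_sig j),
    (exist _ (proj1_sig (fst (projT2 (proj1_sig j))))
       (mono _ _ (proj2_sig j) (proj2_sig (fst (projT2 (proj1_sig j))))),
     snd (projT2 (proj1_sig j)))), 0)).
  intros [[c1 [[x1 h1] k1]] j1] [[c2 [[x2 h2] k2]] j2] e; apply sig_inj; simpl in *.
  inversion e; subst; replace h2 with h1 by apply proof_irrelevance; auto.
Qed.

End Cofinal.

(** * Case distinction on the degree and its cofinality *)

Theorem theorem5p4 :
  GCH -> forall K : CType, ~ cf_succ_of_cof_omega K -> HC K.
Proof.
  intros gch K hK V adj [adj_sym _] E [r0 [ray0 hE]] deg.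
  change (connected_rays adj E K).
  pose proof deg as [[R [hR dis]] _].
  destruct (classic (infinite_type K)) as [inf|fin].
  2: { destruct (finite_of_not_infinite _ fin) as [l hl].
       apply (connected_rays_transfer adj E {i : K | True} K deg).
       - exact (connected_rays_finite adj_sym ray0 hE hR dis l hl).
       - exists (fun k => exist _ k I); intros x y e; inversion e; auto. }
  destruct (classic (le_card K nat)) as [cnt|unc].
  { destruct (connected_family_exists adj_sym ray0 hE hR dis inf) as [D [hD1 hD2]].
    apply (connected_rays_transfer adj E {i : K | D i} K deg).
    - apply (connected_rays_of_edges adj_sym hR dis D); auto.
      eapply le_card_trans; [apply le_card_sig|exact cnt].
    - eapply le_card_trans; [exact cnt|apply unbounded_infinite, hD1]. }
  destruct (initial_order_exists K) as [lt ini].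
  destruct (cofinality_exists K lt (proj1 ini)) as [C [f [finj [cof min]]]].
  destruct (initial_order_exists C) as [ltC iniC].
  (* The assumption on the cofinality is used here, for closure under countable powers. *)
  assert (siC : ~ le_card C nat -> small_ideal (fun A => lt_card A C)).
  { intros uncC; apply (small_ideal_regular C ltC iniC uncC).
    - exact (cofinality_regular ini inf cof min iniC).
    - intros A; apply (gch_cofinality_closed K C A gch hK); auto.
      exists lt; split; auto; split; auto; exists f; auto. }
  destruct (classic (le_card K C)) as [reg|sing].
  { assert (uncC : ~ le_card C nat) by (intros h; apply unc; eapply le_card_trans; eauto).
    destruct (connected_rays_not_small adj_sym ray0 hE hR dis (siC uncC)) as [J [hJ1 hJ2]].
    - intros [_ h]; apply h, (le_card_trans _ K); [exists f; auto|apply le_card_refl].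
    - apply (connected_rays_transfer adj E (option J) K deg hJ2).
      eapply le_card_trans; [exact reg|].
      eapply le_card_trans; [apply not_lt_le_card, hJ1|].
      exists Some; intros x y e; inversion e; auto. }
  apply not_le_lt_card in sing.
  set (D := below (lt := lt) (f := f) (ltC := ltC)).
  set (B := bound (lt := lt) (f := f) (ltC := ltC)).
  assert (si : forall c, small_ideal (fun A => le_card A (B c -> Prop))).
  { intros c; apply small_ideal_power, bound_infinite; auto. }
  (* One hub per stage, as a triple. It exists because [K], a strong limit, exceeds the power set of
     [B c] ([not_small_bound]). *)
  destruct (choice_fun (fun c (t : (nat -> V) * (K -> Prop) * (K -> nat -> list V)) =>
    ~ le_card {i | snd (fst t) i} (B c -> Prop) /\
    hub (adj := adj) (R := R) (fst (fst t)) (snd (fst t)) (snd t))) as [t ht].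
  { intros c; destruct (hub_exists adj_sym hE hR dis (si c)) as [U [Lam [P h]]].
    - apply not_small_bound; auto.
    - exists (U, Lam, P); exact h. }
  assert (fin : forall J : CType, le_card K J -> connected_rays adj E J -> connected_rays adj E K).
  { intros J h1 h2; exact (connected_rays_transfer adj E J K deg h2 h1). }
  assert (inhK : inhabited K) by (destruct inf as [g _]; exact (inhabits (g 0))).
  assert (Dinh : forall c, exists x, D c x) by (intros c; exists (f c); apply below_self; auto).
  assert (infC : infinite_type C) by exact (cofinal_infinite K lt C f ini inf cof).
  destruct (classic (le_card C nat)) as [cntC|uncC].
  - destruct (le_card_surj_inv C nat cntC) as [e he].
    { destruct infC as [g _]; exact (inhabits (g 0)). }
    destruct (singular_countable adj_sym ray0 hE hR iniC D Dinh (below_cover cof) si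
      _ _ _ (fun c => proj2 (ht c)) (fun c => proj1 (ht c)) (small_bound_earlier iniC) e he)
      as [J [h1 h2]]; eauto.
  - destruct (singular_uncountable adj_sym ray0 hE hR iniC D Dinh (below_cover cof) si
      (small_bound_cofinality ini iniC)
      _ _ _ (fun c => proj2 (ht c)) (fun c => proj1 (ht c)) (small_bound_earlier iniC) inhK (siC uncC))
      as [J [h1 h2]]; eauto.
Qed.
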